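(* Let $\varepsilon>0$ and let $P\in\mathbb{Z}[X]$ be a separable polynomial of degree $2$. For all $N\ge2$, $$M_4(N;P)\ll_{P,\varepsilon}N^{3/2+\varepsilon},$$ where $M_4(N;P)$ is the number of tuples $(n_1,n_2,n_3,n_4)\in[N]^4$ such that $P(n_1)P(n_2)P(n_3)P(n_4)$ is a nonzero perfect square and $n_i\ne n_j$ for all $1\le i<j\le4$.
   Context: A polynomial is separable if it has no repeated roots in $\mathbb{C}$. $[N]=\{1,\dots,N\}$. The notation $X\ll_{P,\varepsilon}Y$ means $|X|\le C\,Y$ for a constant $C>0$ depending only on $P$ and $\varepsilon$. *)

(* Defs.v *)
From HB Require Import structures.
From mathcomp Require Import all_boot all_order all_algebra.
From mathcomp Require Import complex.
From mathcomp Require Import all_classical all_reals all_analysis.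

Set Implicit Arguments.
Unset Strict Implicit.
Unset Printing Implicit Defensive.

Import Order.TTheory GRing.Theory Num.Theory.

Local Open Scope ring_scope.

Definition no_repeated_complex_root (R : realType) (P : {poly int}) : Prop :=
  forall z : R[i], ~~ (('X - z%:P) ^+ 2 %| map_poly intr P).

Definition perfect_square (z : int) : Prop := exists m : int, z = m ^+ 2.

(* The index n i : 'I_N ranges over 0, ..., N - 1, so it encodes the integer
   (n i).+1 of {1, ..., N}. *)
Definition M4 (N : nat) (P : {poly int}) : nat :=
  #|[set n : {ffun 'I_4 -> 'I_N} |
      let Q := \prod_(i < 4) P.[(n i).+1%:Z] in
      [&& Q != 0, `[< perfect_square Q >]
        & [forall i : 'I_4, forall j : 'I_4, (i < j)%N ==> (n i != n j)]]]|.

(* Main.v *)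
(* Write |P(n)| = D y^2 with D squarefree, and let g be the largest of the
   gcd(D_1, D_j), where n_1 is the index with the largest D_1; as the product of
   the D_i is a square, D_1 <= g^3. All bounds below are up to a factor N^eps.

   - A congruence e | P(n) has few roots modulo e, so the number of n <= N with
     D of size A and e | D is at most each of A/e, sqrt(A)/e + N/sqrt(A) and
     N/e + 1: in the first case D determines n up to few choices, in the second
     one sums over y.
   - Once n_1 and n_2 are known, D_1 D_2 / g^2 is known and divides D_3 D_4, so
     D_3, say, is divisible by a known divisor which is at least
     sqrt(D_1 D_2) / g; and n_1, n_2, n_3 determine D_4, hence n_4 up to few
     choices.
   - If g is large then the cofactors m_i = P(n_i) / g are small, and m_1, m_2
     determine (n_1, n_2) up to few choices.

   The few-choices claims are about equations al X^2 - be Y^2 = K. Two solutions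
   of comparable size whose determinant is divisible by K coincide, so it is
   enough to spread the solutions over few classes in which K divides all
   determinants. For |P(n)| = D y^2 the constant K is the discriminant and
   residues modulo K do; for P(n_i) = g m_i one factors g compatibly with
   P(n_1) - P(n_2) = (n_1 - n_2)(a(n_1 + n_2) + b).

   Combining the bounds in each dyadic range gives N^(3/2). *)

Require Import Defs.
From HB Require Import structures.
From mathcomp Require Import all_boot all_order all_algebra.
From mathcomp Require Import complex.
From mathcomp Require Import all_classical all_reals all_analysis.
From mathcomp Require Import ring lra zify.

Set Implicit Arguments.
Unset Strict Implicit.
Unset Printing Implicit Defensive.

Import Order.TTheory GRing.Theory Num.Theory.

Local Open Scope ring_scope.

(** * Divisors and squarefree parts *)

(** With [q = j %/ k] one has [j.+1 <= k * q.+1 <= k * 2 ^ q]; take [k]-th powers and use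
    [q * k <= j]. *)
Lemma succ_exp_le (k j : nat) : (0 < k -> j.+1 ^ k <= k ^ k * 2 ^ j)%N.
Proof.
move=> k0.
have h : (j.+1 <= k * 2 ^ (j %/ k))%N.
  apply: (@leq_trans (k * (j %/ k).+1)); last by rewrite leq_mul2l ltn_expl // orbT.
  by rewrite mulnC -ltn_divLR.
apply: (@leq_trans ((k * 2 ^ (j %/ k)) ^ k)); first by rewrite leq_exp2r.
rewrite expnMn leq_mul2l -expnM leq_exp2l //.
by rewrite leq_trunc_div orbT.
Qed.

Lemma size_divisors_pfactor (p j m : nat) : prime p -> (0 < m)%N -> ~~ (p %| m)%N ->
  (size (divisors (p ^ j * m)) <= j.+1 * size (divisors m))%N.
Proof.
move=> pp m0 npm.
rewrite -[j.+1](size_iota 0) -(size_allpairs (fun i d => p ^ i * d)%N).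
apply: uniq_leq_size; first exact: divisors_uniq.
have n0 : (0 < p ^ j * m)%N by rewrite muln_gt0 expn_gt0 prime_gt0.
move=> d; rewrite -dvdn_divisors // => dn.
have d0 := dvdn_gt0 n0 dn.
have [d' cd' dE] := pfactor_coprime pp d0.
apply/allpairsP; exists (logn p d, d'); split.
- rewrite mem_iota /= add0n ltnS.
  have := dvdn_leq_log p n0 dn.
  have pj0 : (0 < p ^ j)%N by rewrite expn_gt0 prime_gt0.
  by rewrite (lognM _ pj0 m0) (pfactorK _ pp) (@logn_coprime p m) ?addn0 // prime_coprime.
- rewrite /= -dvdn_divisors //.
  rewrite -(@Gauss_dvdr d' (p ^ j)); last by rewrite coprimeXr // coprime_sym.
  by apply: dvdn_trans dn; rewrite [X in (_ %| X)%N]dE dvdn_mulr.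
- by rewrite /= mulnC.
Qed.

(** The divisor function is at most a constant times the [k]-th root. Splitting off [p ^ j] costs
    [j.+1 ^ k]: this is at most [p ^ j] when [2 ^ k <= p], and at most [k ^ k * p ^ j] for the at
    most [2 ^ k] smaller primes. *)
Lemma divisor_bound (k n : nat) : (0 < k -> 0 < n ->
  size (divisors n) ^ k <= (k ^ k) ^ (2 ^ k) * n)%N.
Proof.
move=> k0 n0.
pose A n := [set p : 'I_(2 ^ k) | prime p && (p %| n)%N].
(* Counting only the small primes that divide [n] lets the induction pay for them one at a time. *)
suff h : (size (divisors n) ^ k <= (k ^ k) ^ #|A n| * n)%N.
  apply: (leq_trans h); rewrite leq_mul2r leq_pexp2l ?orbT ?expn_gt0 ?k0 //.
  by rewrite -[X in (_ <= X)%N]card_ord max_card.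
elim/ltn_ind: n n0 => n IH n0.
have [n1|n1] := leqP n 1.
  have -> : n = 1%N by lia.
  by rewrite exp1n muln1 expn_gt0 expn_gt0 k0.
have pp := pdiv_prime n1; set p := pdiv n in pp.
have [m cm nE] := pfactor_coprime pp n0.
set j := logn p n in nE.
have m0 : (0 < m)%N by move: n0; rewrite nE muln_gt0 => /andP[].
have npm : ~~ (p %| m)%N by rewrite -prime_coprime.
have j0 : (0 < j)%N by rewrite logn_gt0 mem_primes pp n0 pdiv_dvd.
have pj1 : (1 < p ^ j)%N by rewrite -(exp1n j) ltn_exp2r // prime_gt1.
have mn : (m < n)%N by rewrite nE -[X in (X < _)%N]muln1 ltn_pmul2l.
have {}IH := IH m mn m0.
have h1 : (size (divisors n) ^ k <= j.+1 ^ k * size (divisors m) ^ k)%N.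
  by rewrite -expnMn leq_exp2r // nE mulnC size_divisors_pfactor.
apply: (leq_trans h1); apply: (leq_trans (leq_mul (leqnn _) IH)).
have AmAn : A m \subset A n.
  apply/fintype.subsetP => q; rewrite !inE => /andP[-> qm] /=.
  by rewrite nE dvdn_mulr.
have k1 : (0 < k ^ k)%N by rewrite expn_gt0 k0.
have [pk|pk] := ltnP p (2 ^ k).
- have pA : Ordinal pk \in A n by rewrite inE /= pp pdiv_dvd.
  have h2 : (#|A m| < #|A n|)%N.
    rewrite (cardsD1 (Ordinal pk) (A n)) pA ltnS; apply: subset_leq_card.
    apply/fintype.subsetP => q qA; rewrite !inE.
    move: (fintype.subsetP AmAn _ qA); rewrite inE => ->; rewrite andbT.
    apply/eqP => qE; move: qA; rewrite qE inE /= => /andP[_].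
    by rewrite (negbTE npm).
  apply: (@leq_trans ((k ^ k * p ^ j) * ((k ^ k) ^ #|A m| * m)))%N.
    rewrite leq_mul2r; apply/orP; right.
    apply: (leq_trans (succ_exp_le j k0)).
    by rewrite leq_mul2l leq_exp2r // prime_gt1 // orbT.
  rewrite [X in (_ <= _ * X)%N]nE (mulnC m) mulnACA -expnS.
  by rewrite leq_mul2r leq_pexp2l // orbT.
- apply: (@leq_trans (p ^ j * ((k ^ k) ^ #|A m| * m)))%N.
    rewrite leq_mul2r; apply/orP; right.
    apply: (@leq_trans ((2 ^ j) ^ k)); first by rewrite leq_exp2r // ltn_expl.
    by rewrite -expnM mulnC expnM leq_exp2r.
  rewrite [X in (_ <= _ * X)%N]nE (mulnC m) mulnCA.
  by rewrite leq_mul2r leq_pexp2l ?subset_leq_card // orbT.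
Qed.

Lemma trunc_log_bound (k n : nat) : (0 < k -> 0 < n ->
  (trunc_log 2 n).+1 ^ k <= k ^ k * n)%N.
Proof.
move=> k0 n0; apply: (leq_trans (succ_exp_le _ k0)).
by rewrite leq_mul2l trunc_logP ?orbT.
Qed.

Definition squarefree (d : nat) := forall p : nat, prime p -> ~~ (p ^ 2 %| d)%N.

(** At [m = 0] both this and [sqfree_part] are 0, so [sqfree_partE] holds without positivity. *)
Definition sqroot_part (m : nat) : nat := \max_(y < m.+1 | (y ^ 2 %| m)%N) y.
Definition sqfree_part (m : nat) : nat := (m %/ sqroot_part m ^ 2)%N.

Lemma sqroot_part_dvd m : (sqroot_part m ^ 2 %| m)%N.
Proof.
rewrite /sqroot_part; case: (@eq_bigmax_cond _ [pred y : 'I_m.+1 | (y ^ 2 %| m)%N] (@nat_of_ord _)).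
  case: m => [|m]; first by apply/card_gt0P; exists ord0; rewrite inE.
  by apply/card_gt0P; exists (inord 1); rewrite inE inordK.
by move=> y ym ->.
Qed.

Lemma sqfree_partE m : m = (sqfree_part m * sqroot_part m ^ 2)%N.
Proof. by rewrite divnK // sqroot_part_dvd. Qed.

Lemma sqroot_part_gt0 m : (0 < m -> 0 < sqroot_part m)%N.
Proof. by move=> m0; move: (dvdn_gt0 m0 (sqroot_part_dvd m)); rewrite expn_gt0 orbF. Qed.

Lemma sqfree_part_gt0 m : (0 < m -> 0 < sqfree_part m)%N.
Proof. by move=> m0; move: (m0); rewrite {1}(sqfree_partE m) muln_gt0 => /andP[]. Qed.

Lemma sqfree_part_dvd m : (sqfree_part m %| m)%N.
Proof. by rewrite {2}(sqfree_partE m) dvdn_mulr. Qed.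

(** Otherwise [p * sqroot_part m] would be a larger number whose square divides [m]. *)
Lemma sqfree_partP m : (0 < m)%N -> squarefree (sqfree_part m).
Proof.
move=> m0 p pp; apply/negP => /dvdnP[d dE].
have y0 := sqroot_part_gt0 m0.
have pym : ((p * sqroot_part m) ^ 2 %| m)%N.
  by rewrite {2}(sqfree_partE m) dE expnMn -mulnA dvdn_mull.
have lt : (p * sqroot_part m < m.+1)%N.
  rewrite ltnS; apply: leq_trans (dvdn_leq m0 pym).
  by rewrite -[X in (X <= _)%N]expn1 leq_pexp2l // muln_gt0 prime_gt0.
have := @leq_bigmax_cond _ [pred y : 'I_m.+1 | (y ^ 2 %| m)%N] (@nat_of_ord _) (Ordinal lt) pym.
rewrite -/(sqroot_part m) /= leqNgt -[X in (X < _)%N]mul1n ltn_pmul2r // prime_gt1 //.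
Qed.

Lemma squarefree_logn d p : squarefree d -> (logn p d <= 1)%N.
Proof.
move=> sd; case: (boolP (prime p)) => pp; last by rewrite lognE (negbTE pp).
case: (posnP d) => [->|d0]; first by rewrite logn0.
by rewrite leqNgt -pfactor_dvdn //; exact: sd.
Qed.

Lemma squarefree_gt0 d : squarefree d -> (0 < d)%N.
Proof. by case: d => // /(_ 2 isT). Qed.

Lemma squarefree_dvd d e : squarefree d -> (e %| d)%N -> squarefree e.
Proof.
move=> sd ed p pp; apply/negP => pe.
by have /negP := sd p pp; apply; apply: dvdn_trans ed.
Qed.

Lemma squarefree_dvdn d m : squarefree d -> (0 < m)%N ->
  (forall p, prime p -> (p %| d)%N -> (p %| m)%N) -> (d %| m)%N.
Proof.
move=> sd m0 h; have d0 := squarefree_gt0 sd.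
apply/dvdn_partP => // p; rewrite mem_primes => /and3P[pp _ pd].
rewrite p_part; apply: (@dvdn_trans (p ^ 1)); last by rewrite expn1 h.
by rewrite dvdn_exp2l // squarefree_logn.
Qed.

(** At each prime both valuations are at most 1 and have even sum, hence agree. *)
Lemma eqn_squarefree d e z : squarefree d -> squarefree e -> (d * e = z ^ 2)%N -> d = e.
Proof.
move=> sd se dez.
have d0 := squarefree_gt0 sd; have e0 := squarefree_gt0 se.
apply/eqn_from_log => // p.
have := congr1 (logn p) dez; rewrite lognM // lognX.
by have := squarefree_logn p sd; have := squarefree_logn p se; lia.
Qed.

(** The product of the two squares is [m ^ 2 * (d * e)], so [d * e] is a square. In this way three
    squarefree parts determine the fourth. *)
Lemma eqn_sqfree_part_mul (m d e : nat) : (0 < m)%N -> squarefree d -> squarefree e ->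
  sqfree_part (m * d) = 1%N -> sqfree_part (m * e) = 1%N -> d = e.
Proof.
move=> m0 sd se hd he.
have ud := sqfree_partE (m * d); have ue := sqfree_partE (m * e).
rewrite hd mul1n in ud; rewrite he mul1n in ue.
set u := sqroot_part (m * d) in ud; set v := sqroot_part (m * e) in ue.
have uv : ((u * v) ^ 2 = m ^ 2 * (d * e))%N by rewrite expnMn -ud -ue mulnACA mulnn.
have /dvdnP[w wE] : (m %| u * v)%N by rewrite -(@dvdn_pexp2r _ _ 2) // uv dvdn_mulr.
apply: (@eqn_squarefree _ _ w) => //; apply/eqP.
by rewrite -(@eqn_pmul2l (m ^ 2)) ?expn_gt0 ?m0 // -uv wE expnMn mulnC.
Qed.

Lemma sqfree_part_sqr (z : nat) : (0 < z)%N -> sqfree_part (z ^ 2) = 1%N.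
Proof.
move=> z0; have z20 : (0 < z ^ 2)%N by rewrite expn_gt0 z0.
have /dvdnP[w wE] : (sqroot_part (z ^ 2) %| z)%N.
  by rewrite -(@dvdn_pexp2r _ _ 2) // sqroot_part_dvd.
apply: (@eqn_squarefree _ _ w); [exact: sqfree_partP| |].
  by move=> p pp; rewrite dvdn1 -[1%N](exp1n 2) eqn_exp2r // neq_ltn prime_gt1 ?orbT.
rewrite muln1 /sqfree_part {1}wE expnMn mulnK //.
by rewrite expn_gt0 sqroot_part_gt0.
Qed.

Lemma dvdn_div_gcd (m u w : nat) : (0 < m)%N ->
  (m %| u * w)%N -> (m %/ gcdn m u %| w)%N.
Proof.
move=> m0 muw; have g0 : (0 < gcdn m u)%N by rewrite gcdn_gt0 m0.
by rewrite dvdn_divLR ?dvdn_gcdl // muln_gcdr dvdn_gcd dvdn_mull // mulnC.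
Qed.

Lemma coprime_squarefreeM (d e : nat) : coprime d e -> squarefree d -> squarefree e ->
  squarefree (d * e).
Proof.
move=> cde sd se p pp; apply/negP => pde.
have [pd|pd] := boolP (p %| d)%N.
  have /negP := sd p pp; apply; rewrite -(@Gauss_dvdl _ _ e) // coprimeXl //.
  exact: coprime_dvdl pd cde.
have /negP := se p pp; apply; rewrite -(@Gauss_dvdr _ d) // coprimeXl //.
by rewrite prime_coprime.
Qed.

Lemma coprime_div_gcd (d e : nat) : (0 < d)%N -> coprime (d %/ gcdn d e) (e %/ gcdn d e).
Proof.
move=> d0; have g0 : (0 < gcdn d e)%N by rewrite gcdn_gt0 d0.
rewrite /coprime -(@eqn_pmul2r (gcdn d e)) // muln_gcdl mul1n.
by rewrite !divnK ?dvdn_gcdl ?dvdn_gcdr.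
Qed.

Lemma logn_eq0_ndvd p d : prime p -> (0 < d)%N -> (logn p d == 0%N) = ~~ (p %| d)%N.
Proof. by move=> pp dgt0; rewrite -leqn0 leqNgt logn_gt0 mem_primes pp dgt0. Qed.

(** * Four numbers whose product is a square *)

Section FourSquarefree.
Variables d0 d1 d2 d3 z : nat.
Hypotheses (sf0 : squarefree d0) (sf1 : squarefree d1).
Hypotheses (d2_gt0 : (0 < d2)%N) (d3_gt0 : (0 < d3)%N).
Hypothesis prod_sqr : (d0 * d1 * d2 * d3 = z ^ 2)%N.

Lemma sum_logn_even p : (2 %| logn p d0 + logn p d1 + logn p d2 + logn p d3)%N.
Proof.
have d0_gt0 := squarefree_gt0 sf0; have d1_gt0 := squarefree_gt0 sf1.
rewrite -!lognM ?muln_gt0 ?d0_gt0 ?d1_gt0 ?d2_gt0 // prod_sqr lognX.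
exact: dvdn_mulr.
Qed.

(** A prime of [d0] has valuation 1 there and even total valuation, so it divides another factor.
    Hence [d0] divides the product of its three gcds. *)
Lemma leq_gcd_cube : (d0 <= gcdn d0 d1 ^ 3 \/ d0 <= gcdn d0 d2 ^ 3 \/ d0 <= gcdn d0 d3 ^ 3)%N.
Proof.
have d0_gt0 := squarefree_gt0 sf0; have d1_gt0 := squarefree_gt0 sf1.
have dv : (d0 %| gcdn d0 d1 * gcdn d0 d2 * gcdn d0 d3)%N.
  apply: squarefree_dvdn => //; first by rewrite !muln_gt0 !gcdn_gt0 d0_gt0.
  move=> p pp pd0; rewrite !Euclid_dvdM // !dvdn_gcd pd0 /=.
  apply/negPn/negP; rewrite !negb_or -!(logn_eq0_ndvd pp) // => /andP[/andP[/eqP l1 /eqP l2] /eqP l3].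
  have := sum_logn_even p; rewrite l1 l2 l3 !addn0.
  have : (0 < logn p d0)%N by rewrite logn_gt0 mem_primes pp d0_gt0.
  by case: (logn p d0) (squarefree_logn p sf0) => [|[|]].
have := dvdn_leq _ dv; rewrite !muln_gt0 !gcdn_gt0 d0_gt0 => /(_ isT).
move: (gcdn d0 d1) (gcdn d0 d2) (gcdn d0 d3) => u v w h.
have key t : (u <= t -> v <= t -> w <= t -> d0 <= t ^ 3)%N.
  move=> ut vt wt; apply: (leq_trans h).
  by rewrite !expnS expn0 muln1 mulnA !leq_mul.
have [uv|/ltnW vu] := leqP u v.
  have [vw|/ltnW wv] := leqP v w.
    by right; right; apply: key => //; exact: leq_trans uv vw.
  by right; left; apply: key.
have [uw|/ltnW wu] := leqP u w.
  by right; right; apply: key => //; exact: leq_trans vu uw.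
by left; apply: key.
Qed.

(** A prime of [Q] divides exactly one of [d0] and [d1], so by parity it divides [d2 * d3]. Hence
    [Q] divides [d2 * d3] and is at most [gcdn d2 Q * gcdn d3 Q]. *)
Lemma leq_gcd_core :
  let Q := (d0 %/ gcdn d0 d1 * (d1 %/ gcdn d0 d1))%N in
  (Q <= gcdn d2 Q ^ 2 \/ Q <= gcdn d3 Q ^ 2)%N.
Proof.
have d0_gt0 := squarefree_gt0 sf0; have d1_gt0 := squarefree_gt0 sf1.
move=> Q; set g := gcdn d0 d1 in Q *.
have g0 : (0 < g)%N by rewrite gcdn_gt0 d0_gt0.
have gd0 : (g %| d0)%N := dvdn_gcdl _ _; have gd1 : (g %| d1)%N := dvdn_gcdr _ _.
have sQ : squarefree Q.
  apply: coprime_squarefreeM; first exact: coprime_div_gcd.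
    exact: squarefree_dvd sf0 (dvdn_div gd0).
  exact: squarefree_dvd sf1 (dvdn_div gd1).
have Q0 := squarefree_gt0 sQ.
have logn_le1 p : (logn p d0 <= 1)%N /\ (logn p d1 <= 1)%N by split; exact: squarefree_logn.
have logn_g p : logn p g = minn (logn p d0) (logn p d1) by rewrite logn_gcd.
have dvQ : (Q %| d2 * d3)%N.
  apply: squarefree_dvdn => //; first by rewrite muln_gt0 d2_gt0.
  move=> p pp pQ; rewrite Euclid_dvdM //.
  apply/negPn/negP; rewrite !negb_or -!(logn_eq0_ndvd pp) // => /andP[/eqP l2 /eqP l3].
  have := sum_logn_even p; rewrite l2 l3 !addn0.
  have : (0 < logn p Q)%N by rewrite logn_gt0 mem_primes pp Q0.
  rewrite lognM ?divn_gt0 ?(dvdn_leq d0_gt0 gd0) ?(dvdn_leq d1_gt0 gd1) //.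
  rewrite !logn_div // logn_g; have [] := logn_le1 p.
  by case: (logn p d0) => [|[|]]; case: (logn p d1) => [|[|]].
have f3 : (Q %/ gcdn Q d2 %| gcdn d3 Q)%N.
  by rewrite dvdn_gcd dvdn_div_gcd // dvdn_div // dvdn_gcdl.
have f3le := dvdn_leq _ f3; rewrite gcdn_gt0 d3_gt0 in f3le; move: (f3le isT) => {}f3le.
have QE : (Q = Q %/ gcdn Q d2 * gcdn d2 Q)%N by rewrite (gcdnC d2) divnK // dvdn_gcdl.
have [h|/ltnW h] := leqP (gcdn d3 Q) (gcdn d2 Q).
  left; rewrite {1}QE expnS expn1 leq_mul2r; apply/orP; right.
  exact: leq_trans f3le h.
by right; rewrite {1}QE expnS expn1 leq_mul.
Qed.

End FourSquarefree.

(** * Counting by labels *)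

(** Labels form a list and [r] is only a relation: labels may be arbitrary integers, and neither
    repetitions in [B] nor several labels for one element do harm. *)
Lemma leq_card_union (T : finType) (U : eqType) (S : {set T}) (B : seq U)
    (r : T -> U -> bool) :
  (forall x, x \in S -> exists2 u, u \in B & r x u) ->
  (#|S| <= \sum_(u <- B) #|[set x in S | r x u]|)%N.
Proof.
elim: B S => [|u B IH] S cov.
  rewrite big_nil leqn0 cards_eq0; apply/eqP/setP => x; rewrite inE.
  by apply/negP => /cov[].
rewrite big_cons -(cardsID [set x | r x u] S).
apply: leq_add; first by apply: subset_leq_card; apply/fintype.subsetP => x; rewrite !inE.
apply: leq_trans (IH (S :\: [set x | r x u]) _) _.
  move=> x; rewrite !inE => /andP[nr xS].
  have [v] := cov x xS; rewrite inE => /predU1P[->|vB rv]; first by rewrite (negbTE nr).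
  by exists v.
by apply: leq_sum => v _; apply: subset_leq_card; apply/fintype.subsetP => x; rewrite !inE -andbA => /and3P[_ -> ->].
Qed.

Lemma leq_card_union_const (T : finType) (U : eqType) (S : {set T}) (B : seq U)
    (r : T -> U -> bool) (k : nat) :
  (forall x, x \in S -> exists2 u, u \in B & r x u) ->
  (forall u, u \in B -> #|[set x in S | r x u]| <= k)%N ->
  (#|S| <= size B * k)%N.
Proof.
move=> cov bnd; apply: leq_trans (leq_card_union cov) _.
rewrite -sum1_size big_distrl /=.
by rewrite !big_seq; apply: leq_sum => u uB; rewrite mul1n bnd.
Qed.

Lemma leq_card_label (T : finType) (U : eqType) (S : {set T}) (B : seq U) (f : T -> U) :
  {in S &, injective f} -> (forall x, x \in S -> f x \in B) -> (#|S| <= size B)%N.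
Proof.
move=> inj fB; rewrite -[size B]muln1.
apply: (@leq_card_union_const _ _ _ _ (fun x u => f x == u)) => [x xS|u _].
  by exists (f x) => //; exact: fB.
apply/card_le1P => x; rewrite inE => /andP[xS /eqP fx] y; rewrite !inE.
apply/andP/eqP => [[yS /eqP fy]|->]; last by rewrite fx.
by apply: inj => //; rewrite fx fy.
Qed.

Lemma leq_card_inj (T U : finType) (S : {set T}) (S' : {set U}) (f : T -> U) :
  {in S &, injective f} -> (forall x, x \in S -> f x \in S') -> (#|S| <= #|S'|)%N.
Proof.
move=> inj fS; rewrite [X in (_ <= X)%N]cardE; apply: leq_card_label inj _ => x xS.
by rewrite mem_enum fS.
Qed.

Lemma ler_card_union_const (R : numDomainType) (T : finType) (U : eqType) (S : {set T})
    (B : seq U) (r : T -> U -> bool) (k : R) :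
  (forall x, x \in S -> exists2 u, u \in B & r x u) ->
  (forall u, u \in B -> #|[set x in S | r x u]|%:R <= k) ->
  #|S|%:R <= (size B)%:R * k.
Proof.
move=> cov bnd; apply: (@le_trans _ _ (\sum_(u <- B) #|[set x in S | r x u]|)%:R).
  by rewrite ler_nat leq_card_union.
rewrite natr_sum -sum1_size natr_sum mulr_suml !big_seq; apply: ler_sum => u uB.
by rewrite mul1r bnd.
Qed.

Lemma ler_card_fibers (R : numDomainType) (T U : finType) (X : {set T * U}) (S : {set T})
    (k : R) :
  (forall q, q \in X -> q.1 \in S) ->
  (forall x, x \in S -> #|[set y | (x, y) \in X]|%:R <= k) ->
  #|X|%:R <= #|S|%:R * k.
Proof.
move=> XS bnd; rewrite [#|S|]cardE.
apply: (@ler_card_union_const _ _ _ _ _ (fun q x => q.1 == x)) => [q qX|x].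
  by exists q.1; rewrite // mem_enum XS.
rewrite mem_enum => /bnd; apply: le_trans; rewrite ler_nat.
apply: (@leq_card_inj _ _ _ _ snd) => [[x1 y1] [x2 y2]|[x1 y1]]; rewrite !inE.
  by move=> /andP[_ /eqP /= ->] /andP[_ /eqP /= ->] ->.
by case/andP => h /eqP /= <-.
Qed.

(** * The gap principle *)

Lemma sqr_eq_sign (x y : int) :
  x ^+ 2 = y ^+ 2 -> (0 < x) = (0 < y) -> (x < 0) = (y < 0) -> x = y.
Proof. by move=> /eqP; rewrite eqf_sqr => /orP[/eqP//|/eqP->]; lia. Qed.

(* Two solutions of comparable size with determinant a multiple of [K] coincide:
   if [X * Y' - X' * Y = w * K] then [al * w * (X * Y' + X' * Y) = Y' ^+ 2 - Y ^+ 2]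
   and [be * w * (X * Y' + X' * Y) = X' ^+ 2 - X ^+ 2], too small unless [w = 0]. *)
Lemma gap_pos (al be K X Y X' Y' : int) :
  al != 0 -> be != 0 -> K != 0 ->
  0 < X -> 0 < Y -> 0 < X' -> 0 < Y' ->
  X < 2 * X' -> X' < 2 * X -> Y < 2 * Y' -> Y' < 2 * Y ->
  al * X ^+ 2 - be * Y ^+ 2 = K -> al * X' ^+ 2 - be * Y' ^+ 2 = K ->
  (K %| X * Y' - X' * Y)%Z -> X = X' /\ Y = Y'.
Proof.
move=> al0 be0 K0 X0 Y0 X'0 Y'0 XX' X'X YY' Y'Y eq1 eq2 /dvdzP[w wE].
set S := X * Y' + X' * Y.
have S0 : 0 < S by rewrite addr_gt0 // mulr_gt0.
have hY : al * w * S = Y' ^+ 2 - Y ^+ 2.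
  apply: (mulIf K0).
  have -> : al * w * S * K = al * (X * Y' - X' * Y) * S by rewrite wE; ring.
  rewrite /S -[in RHS]eq1.
  have -> : (Y' ^+ 2 - Y ^+ 2) * (al * X ^+ 2 - be * Y ^+ 2) =
     Y' ^+ 2 * (al * X ^+ 2 - be * Y ^+ 2) - Y ^+ 2 * (al * X ^+ 2 - be * Y ^+ 2) by ring.
  by rewrite [X in _ = _ - _ * X]eq1 -eq2; ring.
have hX : be * w * S = X' ^+ 2 - X ^+ 2.
  apply: (mulIf K0).
  have -> : be * w * S * K = be * (X * Y' - X' * Y) * S by rewrite wE; ring.
  rewrite /S -[in RHS]eq1.
  have -> : (X' ^+ 2 - X ^+ 2) * (al * X ^+ 2 - be * Y ^+ 2) =
     X' ^+ 2 * (al * X ^+ 2 - be * Y ^+ 2) - X ^+ 2 * (al * X ^+ 2 - be * Y ^+ 2) by ring.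
  by rewrite [X in _ = _ - _ * X]eq1 -eq2; ring.
have [w0|w0] := eqVneq w 0.
  move: hY hX; rewrite w0 !mulr0 !mul0r => /esym/eqP hY /esym/eqP hX.
  move: hX hY; rewrite !subr_eq0 => /eqP hX /eqP hY.
  by split; apply: sqr_eq_sign; rewrite ?X0 ?Y0 ?X'0 ?Y'0 //; lia.
exfalso.
have leS (u v : int) : u != 0 -> u * w * S = v -> S <= `|v|.
  move=> u0 <-; rewrite !normrM (gtr0_norm S0).
  have : 0 < `|u| * `|w| by rewrite mulr_gt0 // normr_gt0.
  by move=> h; rewrite -[X in X <= _]mul1r ler_wpM2r // ltW.
(* For [w != 0] both differences of squares are at least [S] in absolute value. Their product is
   shown to be too small for this, whatever its sign. *)
have : S * S <= `|(Y' ^+ 2 - Y ^+ 2) * (X' ^+ 2 - X ^+ 2)|.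
  rewrite normrM; apply: ler_pM; rewrite ?(ltW S0) //; first exact: leS al0 hY.
  exact: leS be0 hX.
rewrite ler_normr => /orP[].
  apply/negP; rewrite -ltNge -subr_gt0.
  set p := X * Y; set q := X' * Y'.
  have p0 : 0 < p by rewrite mulr_gt0.
  have q0 : 0 < q by rewrite mulr_gt0.
  have pq : p < 4 * q.
    have -> : 4 * q = (2 * X') * (2 * Y') by rewrite /q; ring.
    by rewrite ltr_pM // ltW.
  have qp : q < 4 * p.
    have -> : 4 * p = (2 * X) * (2 * Y) by rewrite /p; ring.
    by rewrite ltr_pM // ltW.
  (* Comparability enters through [p < 4 * q] and [q < 4 * p], which make
     [6 * p * q - p ^+ 2 - q ^+ 2] positive. *)
  have -> : S * S - (Y' ^+ 2 - Y ^+ 2) * (X' ^+ 2 - X ^+ 2) =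
    2 * (X * Y' - X' * Y) ^+ 2 + (6 * p * q - p ^+ 2 - q ^+ 2) by rewrite /S /p /q; ring.
  apply: ltr_wpDl; first by rewrite mulr_ge0 // sqr_ge0.
  rewrite -(@pmulr_rgt0 _ 4) //.
  have -> : 4 * (6 * p * q - p ^+ 2 - q ^+ 2) =
    (4 * q - p) * (4 * p - q) + 7 * (p * q) by ring.
  by rewrite addr_gt0 ?mulr_gt0 ?subr_gt0.
apply/negP; rewrite -ltNge -subr_gt0.
have -> : S * S - - ((Y' ^+ 2 - Y ^+ 2) * (X' ^+ 2 - X ^+ 2)) =
    X' ^+ 2 * Y' ^+ 2 + X ^+ 2 * Y ^+ 2 + 2 * (X * X' * Y * Y') by rewrite /S; ring.
by rewrite !addr_gt0 ?mulr_gt0 ?exprn_gt0.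
Qed.

Definition absz_log (x : int) : nat := trunc_log 2 `|x|%N.

Lemma absz_log_lt (x y : int) : y != 0 -> absz_log x = absz_log y -> `|x| < 2 * `|y|.
Proof.
move=> y0 xy.
have h1 : (`|x| < 2 ^ (absz_log x).+1)%N by exact: trunc_log_ltn.
have h2 : (2 ^ absz_log y <= `|y|)%N by apply: trunc_logP; rewrite // lt0n absz_eq0.
move: h1; rewrite xy expnS; lia.
Qed.

(** Equal signs and equal binary logarithms make nonzero coordinates comparable. Zero coordinates
    are settled first, because [absz_log] does not separate 0 from 1 and -1. *)
Lemma gap (al be K X Y X' Y' : int) :
  al != 0 -> be != 0 -> K != 0 ->
  (0 < X) = (0 < X') -> (X < 0) = (X' < 0) -> absz_log X = absz_log X' ->
  (0 < Y) = (0 < Y') -> (Y < 0) = (Y' < 0) -> absz_log Y = absz_log Y' ->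
  al * X ^+ 2 - be * Y ^+ 2 = K -> al * X' ^+ 2 - be * Y' ^+ 2 = K ->
  (K %| X * Y' - X' * Y)%Z -> X = X' /\ Y = Y'.
Proof.
move=> al0 be0 K0 pX nX lX pY nY lY eq1 eq2 dv.
have [X0|X0] := eqVneq X 0.
  have X'0 : X' = 0 by apply/eqP; rewrite eq_le !leNgt -pX -nX X0 ltxx.
  split; first by rewrite X0 X'0.
  apply: sqr_eq_sign => //; apply: (mulfI be0).
  by move: eq2; rewrite -eq1 X0 X'0 expr0n !mulr0 !sub0r => /oppr_inj/esym.
have [Y0|Y0] := eqVneq Y 0.
  have Y'0 : Y' = 0 by apply/eqP; rewrite eq_le !leNgt -pY -nY Y0 ltxx.
  split; last by rewrite Y0 Y'0.
  apply: sqr_eq_sign => //; apply: (mulfI al0).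
  by move: eq2; rewrite -eq1 Y0 Y'0 expr0n !mulr0 !subr0 => /esym.
have X'0 : X' != 0 by move: X0; rewrite !neq_lt pX nX.
have Y'0 : Y' != 0 by move: Y0; rewrite !neq_lt pY nY.
have X1 := absz_log_lt X'0 lX; have X2 := absz_log_lt X0 (esym lX).
have Y1 := absz_log_lt Y'0 lY; have Y2 := absz_log_lt Y0 (esym lY).
(* Each coordinate has the same sign in both solutions, so passing to absolute values only
   multiplies the determinant by [s * t]. *)
have sgE (x x' : int) : (0 < x) = (0 < x') -> x != 0 -> x' != 0 ->
   exists2 s : int, s ^+ 2 = 1 & x = s * `|x| /\ x' = s * `|x'|.
  move=> px x0 x'0; exists (if 0 < x then 1 else -1); first by case: ifP.
  case: ifP px => [x1 /esym x'1|/negbT x1 /esym/negbT x'1].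
    by rewrite !mul1r !gtr0_norm.
  by rewrite !mulN1r !ler0_norm ?opprK // leNgt.
have [s s2 [XE X'E]] := sgE _ _ pX X0 X'0.
have [t t2 [YE Y'E]] := sgE _ _ pY Y0 Y'0.
have [] := @gap_pos al be K `|X| `|Y| `|X'| `|Y'| => //; rewrite ?normr_gt0 ?real_normK ?num_real //.
  have -> : `|X| * `|Y'| - `|X'| * `|Y| = s * t * (X * Y' - X' * Y).
    rewrite {2}XE {2}Y'E {2}X'E {2}YE.
    transitivity (s ^+ 2 * t ^+ 2 * (`|X| * `|Y'| - `|X'| * `|Y|)); last by ring.
    by rewrite s2 t2; ring.
  by rewrite dvdz_mull.
by move=> eX eY; rewrite XE YE eX eY -X'E -Y'E.
Qed.

(** * Combining the bounds *)

(* Here [N = s ^+ 2], the numbers [D_1], [D_2], [D_3] have sizes [x ^+ 2], [y ^+ 2],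
   [z ^+ 2], and [gcd(D_1, D_2)] has size [G]; [p] counts the pairs [(n_1, n_2)] and [w]
   the continuations [(n_3, n_4)] of a pair, both divided by the subpolynomial losses.
   The cases are [x <= s], then [G <= s ^+ 2], then [G > s ^+ 2]; only the last one uses
   the bound [s ^+ 4 * x * y / G ^+ 2]. *)
Lemma exponent_bound (R : realFieldType) (c s x y z G p w : R) :
  1 <= c -> 1 <= s -> 0 < x -> 0 < y -> 0 < z -> 0 < G -> 0 <= p -> 0 <= w ->
  y <= x -> z <= x -> x ^+ 2 <= c * s ^+ 4 -> x ^+ 2 <= 8 * G ^+ 3 -> G <= y ^+ 2 ->
  p <= (x + s ^+ 2 / x) * (y ^+ 2 / G) ->
  p <= (x + s ^+ 2 / x) * (s ^+ 2 / G + 1) ->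
  p <= (y + s ^+ 2 / y) * (s ^+ 2 / G + 1) ->
  p <= s ^+ 4 * x * y / G ^+ 2 ->
  w <= 2 * G * z ^+ 2 / (x * y) ->
  w <= 2 * G * z / (x * y) + s ^+ 2 / z ->
  w <= 2 * G * s ^+ 2 / (x * y) + 1 ->
  p * w <= 16 * c * s ^+ 3.
Proof.
move=> c1 s1 x0 y0 z0 G0 p0 w0 yx zx xc xG Gy p1 p2 p3 p4 w1 w2 w3.
have s0 : 0 < s by apply: lt_le_trans s1.
have c0 : 0 < c by apply: lt_le_trans c1.
have [x00 y00 z00 G00] : [/\ 0 <= x, 0 <= y, 0 <= z & 0 <= G] by split; apply: ltW.
have [s00 c00] : 0 <= s /\ 0 <= c by split; apply: ltW.
have s30 : 0 < s ^+ 3 by rewrite exprn_gt0.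
have s300 := ltW s30.
have [xs|sx] := leP x s.
  (* For [x <= s] the first bounds on [p] and [w] suffice, and [G] cancels in their product. *)
  have q1 : p <= 2 * s ^+ 2 / x * (y ^+ 2 / G).
    apply: (le_trans p1); apply: ler_wpM2r; first by rewrite divr_ge0 ?exprn_ge0.
    rewrite ler_pdivlMr // mulrDl divfK ?gt_eqF // mulr2n mulrDl mul1r lerD2r.
    by rewrite expr2 ler_pM //.
  apply: (le_trans (ler_pM p0 w0 q1 w1)).
  have -> : 2 * s ^+ 2 / x * (y ^+ 2 / G) * (2 * G * z ^+ 2 / (x * y)) =
     4 * s ^+ 2 * y * (z / x) ^+ 2 by field; rewrite !gt_eqF.
  have zx1 : (z / x) ^+ 2 <= 1 by rewrite expr_le1 ?divr_ge0 // ler_pdivrMr // mul1r.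
  apply: (@le_trans _ _ (4 * s ^+ 2 * y * 1)).
    by rewrite ler_wpM2l // !mulr_ge0 ?exprn_ge0.
  rewrite mulr1; apply: (@le_trans _ _ (4 * s ^+ 2 * s)).
    by rewrite ler_wpM2l ?mulr_ge0 ?exprn_ge0 // (le_trans yx).
  rewrite -mulrA -exprSr ler_wpM2r //; move: c1; clear; lra.
have sx' := ltW sx.
have sxx : s ^+ 2 / x <= x by rewrite ler_pdivrMr // expr2 ler_pM //.
have [Gs|sG] := leP G (s ^+ 2).
  (* The witness [m] merges the first two bounds on [p]: it is [y ^+ 2] if [y <= s] and [2 * s ^+ 2]
     otherwise. *)
  have [m [my ms mys m0]] : exists m, [/\ m <= 2 * s ^+ 2, p <= 2 * x * m / G, m <= 2 * y * s & 0 <= m].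
    have [ys|sy] := leP y s.
      exists (y ^+ 2); split; [ | | |by rewrite exprn_ge0 //].
        apply: (@le_trans _ _ (s ^+ 2)); first by rewrite ler_pXn2r.
        by rewrite ler_peMl ?exprn_ge0 // ler1n.
        apply: (le_trans p1); rewrite -mulrA; apply: ler_wpM2r; first by rewrite divr_ge0 ?exprn_ge0.
        by lra.
      by rewrite expr2; have : y * y <= y * s; [rewrite ler_wpM2l // | have : 0 < y * s by rewrite mulr_gt0]; lra.
    have sy' := ltW sy.
    exists (2 * s ^+ 2); split; [by []| | |by rewrite mulr_ge0 // exprn_ge0 //].
      apply: (le_trans p2); rewrite -mulrA; apply: ler_pM => //.
      - by rewrite addr_ge0 ?divr_ge0 ?exprn_ge0.
      - by rewrite addr_ge0 // divr_ge0 ?exprn_ge0.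
      - by lra.
      - have : 1 <= s ^+ 2 / G by rewrite ler_pdivlMr // mul1r.
        by rewrite -(mulrA 2); move: (s ^+ 2 / G) => u; clear; lra.
    by rewrite -mulrA ler_wpM2l // expr2 ler_wpM2r //.
  apply: (le_trans (ler_pM p0 w0 ms w3)).
  have -> : 2 * x * m / G * (2 * G * s ^+ 2 / (x * y) + 1) =
    4 * s ^+ 2 * (m / y) + 2 * x * m / G by field; rewrite !gt_eqF.
  have e1 : m / y <= 2 * s by rewrite ler_pdivrMr // mulrAC.
  (* The sixth power uses [x ^+ 2 <= c * s ^+ 4] once and [x ^+ 2 <= 8 * G ^+ 3] twice. *)
  have xsG : x <= 2 * c * (s * G).
    rewrite -(@ler_pXn2r _ 6) ?nnegrE ?mulr_ge0 //.
    have -> : x ^+ 6 = x ^+ 2 * (x ^+ 2) ^+ 2 by ring.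
    have -> : (2 * c * (s * G)) ^+ 6 = (c * s ^+ 4) * (8 * G ^+ 3) ^+ 2 * (c ^+ 5 * s ^+ 2) by ring.
    rewrite -[leLHS]mulr1; apply: ler_pM => //; rewrite ?mulr_ge0 ?exprn_ge0 //.
      apply: ler_pM; rewrite ?exprn_ge0 //.
      by rewrite ler_pXn2r ?nnegrE ?mulr_ge0 ?exprn_ge0.
    by rewrite -[1]mulr1; apply: ler_pM; rewrite ?exprn_ege1.
  have e2 : 2 * x * m / G <= 8 * c * s ^+ 3.
    rewrite ler_pdivrMr //; apply: (@le_trans _ _ (2 * (2 * c * (s * G)) * (2 * s ^+ 2))).
      by apply: ler_pM; rewrite ?ler_wpM2l ?mulr_ge0.
    by rewrite le_eqVlt; apply/orP; left; apply/eqP; ring.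
  apply: (@le_trans _ _ (4 * s ^+ 2 * (2 * s) + 8 * c * s ^+ 3)).
    by apply: lerD => //; rewrite ler_wpM2l // mulr_ge0 // exprn_ge0 //.
  have -> : 4 * s ^+ 2 * (2 * s) = 8 * 1 * s ^+ 3 by ring.
  have : 1 * s ^+ 3 <= c * s ^+ 3 by rewrite ler_wpM2r //.
  by rewrite -!mulrA; lra.
have sG' := ltW sG.
have sy : s <= y.
  by rewrite -(@ler_pXn2r _ 2) ?nnegrE //; exact: le_trans sG' Gy.
have q3 : p <= 4 * y.
  apply: (le_trans p3).
  have h1 : s ^+ 2 / y <= y by rewrite ler_pdivrMr // expr2 ler_pM //.
  have h2 : s ^+ 2 / G <= 1 by rewrite ler_pdivrMr // mul1r ltW.
  have -> : 4 * y = (y + y) * (1 + 1) by ring.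
  by apply: ler_pM; rewrite ?addr_ge0 ?divr_ge0 ?exprn_ge0 ?lerD // ?lerD2l ?lerD2r.
have xcs : x <= c * s ^+ 2.
  rewrite -(@ler_pXn2r _ 2) ?nnegrE ?mulr_ge0 ?exprn_ge0 //.
  apply: (le_trans xc); rewrite exprMn -exprM ler_wpM2r ?exprn_ge0 //.
  by rewrite expr2 -[leLHS]mul1r ler_wpM2r.
have q2 : w <= 2 * G / y + s ^+ 2 / z.
  apply: (le_trans w2); rewrite lerD2r.
  have -> : 2 * G * z / (x * y) = 2 * G / y * (z / x) by field; rewrite !gt_eqF.
  rewrite -[leRHS]mulr1 ler_wpM2l ?divr_ge0 ?mulr_ge0 //.
  by rewrite ler_pdivrMr // mul1r.
have p8 : p * w <= 8 * c * s ^+ 3; last first.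
  apply: (le_trans p8); rewrite ler_wpM2r // ler_wpM2r //; lra.
have pw0 : 0 <= p * w by rewrite mulr_ge0.
have b0 : 0 <= 8 * c * s ^+ 3 by rewrite !mulr_ge0 ?exprn_ge0.
have [h|h] := leP (s ^+ 2 / z) (2 * G / y).
  have w4 : w <= 4 * G / y by move: h q2; rewrite -!mulrA; move: (G / y) => u; lra.
  (* In the square of [p * w] one factor [p] is bounded by [4 * y] and the other by [p4], so that
     [G] cancels. *)
  rewrite -(@ler_pXn2r _ 2) ?nnegrE //.
  apply: (@le_trans _ _ ((4 * y * (4 * G / y)) * (s ^+ 4 * x * y / G ^+ 2 * (4 * G / y)))).
    by rewrite expr2; apply: ler_pM => //; apply: ler_pM.
  have -> : (4 * y * (4 * G / y)) * (s ^+ 4 * x * y / G ^+ 2 * (4 * G / y)) = 64 * s ^+ 4 * x.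
    by field; rewrite !gt_eqF.
  apply: (@le_trans _ _ (64 * s ^+ 4 * (c * s ^+ 2))).
    by rewrite ler_wpM2l // mulr_ge0 // exprn_ge0 //.
  have -> : (8 * c * s ^+ 3) ^+ 2 = 64 * s ^+ 4 * (c * s ^+ 2) * c by ring.
  by rewrite -[leLHS]mulr1 ler_wpM2l // !mulr_ge0 ?exprn_ge0.
have w4 : w <= 2 * s ^+ 2 / z by move: h q2; rewrite -!mulrA; move: (s ^+ 2 / z) (2 * _) => u v; lra.
rewrite -(@ler_pXn2r _ 6) ?nnegrE //.
(* The weights make [G] and [z] cancel: five factors [p] take [4 * y] and one takes [p4]; four
   factors [w] take [w4] and two take [w1]. *)
have -> : (p * w) ^+ 6 = p ^+ 5 * p * (w ^+ 4 * w ^+ 2) by ring.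
apply: (@le_trans _ _ ((4 * y) ^+ 5 * (s ^+ 4 * x * y / G ^+ 2) * ((2 * s ^+ 2 / z) ^+ 4 * (2 * G * z ^+ 2 / (x * y)) ^+ 2))).
  apply: ler_pM; rewrite ?mulr_ge0 ?exprn_ge0 //; apply: ler_pM; rewrite ?exprn_ge0 //.
  - by rewrite ler_pXn2r ?nnegrE ?mulr_ge0 //.
  - by rewrite ler_pXn2r ?nnegrE // (le_trans w0).
  - by rewrite ler_pXn2r ?nnegrE // (le_trans w0).
have -> : (4 * y) ^+ 5 * (s ^+ 4 * x * y / G ^+ 2) * ((2 * s ^+ 2 / z) ^+ 4 * (2 * G * z ^+ 2 / (x * y)) ^+ 2)
  = 4 ^+ 8 * s ^+ 12 * y ^+ 3 * (y / x) by field; rewrite !gt_eqF.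
apply: (@le_trans _ _ (4 ^+ 8 * s ^+ 12 * (c * s ^+ 2) ^+ 3 * 1)).
  have k1 : y ^+ 3 <= (c * s ^+ 2) ^+ 3.
    rewrite ler_pXn2r ?nnegrE ?mulr_ge0 ?exprn_ge0 //.
    exact: le_trans xcs.
  have k2 : y / x <= 1 by rewrite ler_pdivrMr // mul1r.
  have k3 : 0 <= 4 ^+ 8 * s ^+ 12 by rewrite mulr_ge0 ?exprn_ge0.
  apply: ler_pM => //; [by rewrite mulr_ge0 ?exprn_ge0|exact: divr_ge0|exact: ler_wpM2l].
have -> : (8 * c * s ^+ 3) ^+ 6 = (4 ^+ 8 * s ^+ 12 * (c * s ^+ 2) ^+ 3) * (4 * c ^+ 3) by ring.
rewrite ler_wpM2l ?mulr_ge0 ?exprn_ge0 //.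
by have : 1 <= c ^+ 3 by [rewrite exprn_ege1]; lra.
Qed.

(** * Auxiliary facts on divisibility, harmonic sums and four indices *)

Lemma dvdn_mul_gcd (d k x : nat) : (d %| x)%N -> (k %| x)%N ->
  (d * k %| gcdn d k * x)%N.
Proof.
by move=> dx kx; rewrite muln_gcdl dvdn_gcd dvdn_mul // mulnC dvdn_mul.
Qed.

Lemma ler_divn (R : numFieldType) (m n : nat) : (m %/ n)%:R <= m%:R / n%:R :> R.
Proof.
have [->|n0] := posnP n; first by rewrite divn0 invr0 mulr0.
by rewrite ler_pdivlMr ?ltr0n // -natrM ler_nat leq_trunc_div.
Qed.

(** Each dyadic block contributes at most 1. *)
Lemma harmonic_le_log (R : numFieldType) (Y : nat) :
  \sum_(y <- iota 1 Y) (y%:R)^-1 <= (trunc_log 2 Y).+1%:R :> R.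
Proof.
have dyadic k : \sum_(1 <= y < 2 ^ k) (y%:R)^-1 <= k%:R :> R.
  elim: k => [|k IH]; first by rewrite big_geq.
  have p0 : (0 < 2 ^ k)%N by rewrite expn_gt0.
  rewrite (@big_cat_nat _ _ _ (2 ^ k)) ?leq_exp2l //= -natr1 lerD //.
  apply: (@le_trans _ _ (\sum_(2 ^ k <= y < 2 ^ k.+1) ((2 ^ k)%:R)^-1)).
    apply: ler_sum_nat => y /andP[ky _].
    by rewrite lef_pV2 ?posrE ?ltr0n ?ler_nat // (leq_trans p0).
  by rewrite sumr_const_nat expnS mul2n -addnn addnK -[X in X <= _]mulr_natr mulVf ?pnatr_eq0 ?expn_eq0.
apply: le_trans (dyadic _).
have -> : iota 1 Y = index_iota 1 Y.+1 by rewrite /index_iota subn1.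
rewrite [leRHS](@big_cat_nat _ _ _ Y.+1) //=; last exact: trunc_log_ltn.
by rewrite lerDl; apply: sumr_ge0 => y _; rewrite invr_ge0.
Qed.

Lemma leq_sqr_mul (t m : nat) : (0 < t)%N -> (m <= (t * m) ^ 2)%N.
Proof.
move=> t0; apply: (@leq_trans (t * m)); first by rewrite leq_pmull.
by case: (t * m)%N => // k; rewrite expnS expn1 leq_pmulr.
Qed.

Lemma perm_eq_enum_ord4 (i j k l : 'I_4) : uniq [:: i; j; k; l] ->
  perm_eq [:: i; j; k; l] (enum 'I_4).
Proof.
move=> u; apply: uniq_perm => //; first exact: enum_uniq.
have [] := uniq_min_size u (s2 := enum 'I_4) _ _ => // [t _|]; first by rewrite mem_enum.
by rewrite size_enum_ord.
Qed.

Lemma prod_ord4 (F : 'I_4 -> nat) (i j k l : 'I_4) : uniq [:: i; j; k; l] ->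
  (\prod_t F t = F i * F j * F k * F l)%N.
Proof.
move=> /perm_eq_enum_ord4 pe; transitivity (\prod_(t <- [:: i; j; k; l]) F t)%N.
  by rewrite (perm_big _ pe) big_enum.
by rewrite !big_cons big_nil muln1 !mulnA.
Qed.

Lemma ord4_neq (i : 'I_4) : exists j : 'I_4, i != j.
Proof. by have [->|i0] := eqVneq i ord0; [exists ord_max|exists ord0]. Qed.

Lemma ord4_complete (i j : 'I_4) : i != j -> exists k l : 'I_4, uniq [:: i; j; k; l].
Proof.
move=> ij; have : (#|~: [set i; j]| == 2)%N by rewrite cardsCs finset.setCK cards2 ij card_ord.
case/cards2P => k [l [kl E]]; exists k, l.
have notin t : t \in [set k; l] -> (i != t) && (j != t).
  by rewrite -E !inE negb_or (eq_sym t) (eq_sym t).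
have /andP[ik jk] := notin k (set21 _ _); have /andP[il jl] := notin l (set22 _ _).
by rewrite /= !inE !negb_or ij ik il jk jl kl.
Qed.

Definition bools := [:: true; false].

Lemma mem_bools (x : bool) : x \in bools. Proof. by case: x. Qed.

(** * Values of a quadratic polynomial *)

Section Quadratic.
Variables a b c : int.
Hypothesis a_neq0 : a != 0.
Definition disc : int := b ^+ 2 - 4 * a * c.

Definition qval (n : nat) : int := a * n%:Z ^+ 2 + b * n%:Z + c.
Definition qabs (n : nat) : nat := `|qval n|%N.
(** The derivative of the quadratic, which completes the square in [qlin_sqr]. *)
Definition qlin (n : nat) : int := 2 * a * n%:Z + b.

Lemma qval_sub (m n : nat) :
  qval m - qval n = (m%:Z - n%:Z) * (a * (m%:Z + n%:Z) + b).
Proof. by rewrite /qval; ring. Qed.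

Lemma qlin_sqr (n : nat) : qlin n ^+ 2 - 4 * a * qval n = disc.
Proof. by rewrite /qlin /qval /disc; ring. Qed.

Lemma qlin_inj (m n : nat) : qlin m = qlin n -> m = n.
Proof.
move=> /addIr /(mulfI _) h; apply/eqP; rewrite -eqz_nat; apply/eqP/h.
by rewrite mulf_neq0.
Qed.

Lemma qabs_bounds : exists2 c0 : nat, (0 < c0)%N & forall n : nat, (0 < n)%N ->
  [/\ (qabs n <= c0 * n ^ 2)%N, (0 < qabs n)%N -> (n ^ 2 <= c0 * qabs n)%N
    & (`|qlin n| <= c0 * n)%N].
Proof.
pose H := (`|a| + `|b| + `|c|)%N.
have a1 : (0 < `|a|)%N by rewrite absz_gt0.
have H1 : (0 < H)%N by rewrite /H; lia.
(* For [n < 2 * H] one has [n ^ 2 <= 4 * H ^ 2]; beyond that the lower terms are at most half of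
   [n ^ 2], so [n ^ 2 <= 2 * qabs n]. *)
pose c0 := (4 * H ^ 2)%N; exists c0; first by rewrite muln_gt0 expn_gt0 H1.
move=> n n0.
have HH : (H <= 4 * H ^ 2)%N by rewrite expnS expn1; rewrite mulnA leq_pmull // muln_gt0.
have nA : `|(a * n%:Z ^+ 2)%R|%N = (`|a| * n ^ 2)%N by rewrite abszM abszX.
have nB : `|(b * n%:Z)%R|%N = (`|b| * n)%N by rewrite abszM.
have [up lo] : (qabs n <= `|a| * n ^ 2 + `|b| * n + `|c|)%N /\
    (`|a| * n ^ 2 <= qabs n + `|b| * n + `|c|)%N.
  rewrite -nA -nB /qabs /qval; move: (a * _) (b * _) => A B; clear; lia.
have n2 : (n <= n ^ 2)%N by rewrite expnS expn1 leq_pmulr.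
have lin : (`|qlin n| <= c0 * n)%N.
  apply: (@leq_trans (2 * H * n)); last first.
    by rewrite leq_mul2r /c0 expnS expn1; apply/orP; right; apply: leq_mul => //; rewrite leq_pmulr.
  have : (`|qlin n| <= 2 * `|a| * n + `|b|)%N.
    have : `|(2 * a * n%:Z)%R|%N = (2 * `|a| * n)%N by rewrite !abszM.
    rewrite /qlin; move: (2 * a * _) (2 * _ * _)%N => A B; clear; lia.
  move/leq_trans; apply.
  have -> : (2 * H = 2 * `|a| + 2 * (`|b| + `|c|))%N by rewrite /H; clear; lia.
  by rewrite mulnDl leq_add2l (leq_trans _ (leq_pmulr _ n0)) //; clear; lia.
split=> //.
  apply: (leq_trans up); apply: (@leq_trans (H * n ^ 2)); last by rewrite leq_mul2r HH orbT.
  rewrite /H !mulnDl !leq_add // ?leq_mul2l ?n2 ?orbT //.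
  by rewrite leq_pmulr // expn_gt0 n0.
move=> P0; have [nH|Hn] := ltnP n (2 * H).
  apply: (@leq_trans (4 * H ^ 2)); last by rewrite leq_pmulr.
  have -> : (4 * H ^ 2 = (2 * H) ^ 2)%N by rewrite expnMn.
  by rewrite leq_exp2r // ltnW.
have h1 : (`|b| * n + `|c| <= H * n)%N.
  rewrite /H !mulnDl -addnA; apply: leq_trans (leq_addl _ _).
  by rewrite leq_add2l leq_pmulr.
have h2 : (2 * H * n <= n ^ 2)%N by rewrite expnS expn1 leq_mul2r Hn orbT.
have h3 : (n ^ 2 <= `|a| * n ^ 2)%N by rewrite leq_pmull.
apply: (@leq_trans (2 * qabs n)); first by move: lo h1 h2 h3; rewrite -mulnA; clear; lia.
by rewrite leq_mul2r; apply/orP; right; rewrite (leq_trans _ (leq_pmulr _ _)) ?expn_gt0 ?H1.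
Qed.

(** * Roots of quadratic congruences *)

Hypothesis disc_neq0 : disc != 0.

Definition kappa : nat := `|(a * disc)%R|%N.

Lemma kappa_gt0 : (0 < kappa)%N.
Proof. by rewrite absz_gt0 mulf_neq0. Qed.

(** Fix a root [i0]. By [qval_sub], each root [i] splits [m] into [d], the gcd of [m] with [i - i0],
    and [m %/ d], which divides the other factor. For two roots with the same [d], [m] divides their
    difference times [a * gcdn d (m %/ d)], and this gcd divides [disc]. So they agree modulo [q],
    and [i %/ q] tells them apart. *)
Lemma card_dvd_qabs (m M K : nat) : (0 < m)%N ->
  (#|[set i : 'I_K | (i < M)%N && (m %| qabs i.+1)%N]| <= size (divisors m) * (kappa * M %/ m).+1)%N.
Proof.
move=> m0; set S := [set i : 'I_K | _].
have [->|[i0 i0S]] := set_0Vmem S; first by rewrite cards0.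
pose r (i : 'I_K) d := d == gcdn m `|i.+1%:Z - i0.+1%:Z|%N.
apply: (@leq_card_union_const _ _ _ _ r).
  move=> i iS; exists (gcdn m `|i.+1%:Z - i0.+1%:Z|%N); last by rewrite /r.
  by rewrite -dvdn_divisors // dvdn_gcdl.
move=> d dm.
pose q := (m %/ gcdn m kappa)%N.
have q0 : (0 < q)%N.
  by rewrite divn_gt0 ?gcdn_gt0 ?m0 // (dvdn_leq m0) // dvdn_gcdl.
rewrite -[X in (_ <= X)%N](size_iota 0).
apply: (@leq_card_label _ _ _ _ (fun i : 'I_K => i %/ q)%N); last first.
  move=> i; rewrite inE => /andP[]; rewrite inE => /andP[iM _] _; rewrite mem_iota /= add0n ltnS leq_divRL //.
  apply: (@leq_trans (i %/ q * (q * kappa))%N).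
    rewrite leq_mul2l -{1}(divnK (dvdn_gcdl m kappa)) leq_mul2l.
    by rewrite (dvdn_leq kappa_gt0) ?orbT ?dvdn_gcdr.
  by rewrite mulnA mulnC leq_mul2l (leq_trans (leq_trunc_div _ _)) ?orbT // ltnW.
have d0 : (0 < d)%N by move: dm; rewrite -dvdn_divisors // => /dvdn_gt0; apply.
have split_root (i : 'I_K) : i \in S -> r i d ->
    (d %| `|i.+1%:Z - i0.+1%:Z|)%N /\ ((m %/ d)%:Z %| a * (i.+1%:Z + i0.+1%:Z) + b)%Z.
  rewrite inE => /andP[_ iS] /eqP dE; split; first by rewrite dE dvdn_gcdr.
  rewrite dvdzE /= {1}dE; apply: dvdn_div_gcd => //.
  rewrite -abszM -qval_sub; have : (m%:Z %| qval i.+1 - qval i0.+1)%Z.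
    by apply: rpredB; rewrite dvdzE //=; move: i0S; rewrite inE => /andP[].
  by rewrite dvdzE.
have key (i j : 'I_K) : i \in S -> j \in S -> r i d -> r j d ->
   (m %| kappa * `|i%:Z - j%:Z|)%N.
  move=> iS jS ri rj.
  have [di ki] := split_root i iS ri; have [dj kj] := split_root j jS rj.
  have dij : (d%:Z %| i%:Z - j%:Z)%Z.
    have -> : i%:Z - j%:Z = (i.+1%:Z - i0.+1%:Z) - (j.+1%:Z - i0.+1%:Z) by rewrite !intS; ring.
    by apply: rpredB; rewrite dvdzE.
  have kij : ((m %/ d)%:Z %| a * (i%:Z - j%:Z))%Z.
    have -> : a * (i%:Z - j%:Z) = (a * (i.+1%:Z + i0.+1%:Z) + b) -
       (a * (j.+1%:Z + i0.+1%:Z) + b) by rewrite !intS; ring.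
    exact: rpredB.
  have dm' : (d %| m)%N by rewrite dvdn_divisors.
  (* A common divisor of [d] and [m %/ d] divides both [qlin] and [qval] at [i0.+1]: modulo it, [i0]
     is a double root. *)
  have hdisc : ((gcdn d (m %/ d))%:Z %| disc)%Z.
    set h := gcdn _ _.
    have h1 : (h%:Z %| i.+1%:Z - i0.+1%:Z)%Z by rewrite dvdzE /= (dvdn_trans (dvdn_gcdl _ _)).
    have h2 : (h%:Z %| a * (i.+1%:Z + i0.+1%:Z) + b)%Z.
      by apply: dvdz_trans ki; rewrite dvdzE /= dvdn_gcdr.
    have h3 : (h%:Z %| qval i0.+1)%Z.
      rewrite dvdzE /=; move: i0S; rewrite inE => /andP[_]; apply: dvdn_trans.
      exact: dvdn_trans (dvdn_gcdl _ _) dm'.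
    rewrite -(qlin_sqr i0.+1); apply: rpredB; last by rewrite dvdz_mull.
    have -> : qlin i0.+1 = (a * (i.+1%:Z + i0.+1%:Z) + b) - a * (i.+1%:Z - i0.+1%:Z).
      by rewrite /qlin; ring.
    by rewrite expr2 dvdz_mulr // rpredB // dvdz_mull.
  rewrite -{1}(divnK dm') mulnC.
  apply: (dvdn_trans (dvdn_mul_gcd (x := `|(a * (i%:Z - j%:Z))%R|%N) _ _)).
  - by rewrite abszM dvdn_mull.
  - exact: kij.
  rewrite /kappa !abszM mulnA [X in (_ %| X * _)%N]mulnC dvdn_mul //.
  by rewrite dvdn_mul.
move=> i j; rewrite !inE => /andP[iS ri] /andP[jS rj] ij.
have := key i j; rewrite !inE => /(_ iS jS ri rj) /(dvdn_div_gcd m0) qij.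
apply: val_inj => /=; rewrite (divn_eq i q) (divn_eq j q) ij; congr (_ + _)%N.
have : (i%:Z == j%:Z %[mod q%:Z])%Z by rewrite eqz_mod_dvd dvdzE.
by rewrite !modz_nat => /eqP[].
Qed.

(** * Equations with few solutions *)

Lemma modn_eq_dvdz (d : int) (m n : nat) :
  (m %% `|d| = n %% `|d|)%N -> (d %| m%:Z - n%:Z)%Z.
Proof.
move=> mn; have : (m%:Z == n%:Z %[mod `|d|%N%:Z])%Z by rewrite !modz_nat mn.
by rewrite eqz_mod_dvd !dvdzE.
Qed.

(* [W] dominates the divisor function and the binary logarithm at all numbers that occur. *)
Variables c0 N W : nat.
Hypothesis qabs_le : forall n : nat, (0 < n)%N -> (qabs n <= c0 * n ^ 2)%N.
Hypothesis le_qabs : forall n : nat, (0 < n)%N -> (0 < qabs n)%N -> (n ^ 2 <= c0 * qabs n)%N.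
Hypothesis qlin_le : forall n : nat, (0 < n)%N -> (`|qlin n| <= c0 * n)%N.
Hypothesis divisors_le_W : forall m : nat, (m <= (2 * c0 * N ^ 2) ^ 2)%N -> (size (divisors m) <= W)%N.
Hypothesis log_lt_W : forall m : nat, (m <= (2 * c0 * N ^ 2) ^ 2)%N -> (trunc_log 2 m < W)%N.

Lemma le_sqr_bound (m : nat) : (m <= 2 * c0 * N ^ 2 -> m <= (2 * c0 * N ^ 2) ^ 2)%N.
Proof. by move/leq_trans; apply; case: (_ * _)%N => // k; rewrite expnS expn1 leq_pmulr. Qed.

Lemma divisors_le (m : nat) : (m <= 2 * c0 * N ^ 2)%N -> (size (divisors m) <= W)%N.
Proof. by move=> h; apply/divisors_le_W/le_sqr_bound. Qed.

Lemma log_lt (m : nat) : (m <= 2 * c0 * N ^ 2)%N -> (trunc_log 2 m < W)%N.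
Proof. by move=> h; apply/log_lt_W/le_sqr_bound. Qed.

Lemma qabs_le_N (i : 'I_N) : (qabs i.+1 <= c0 * N ^ 2)%N.
Proof.
by apply: leq_trans (qabs_le _) _; rewrite // leq_mul2l leq_exp2r // ltn_ord orbT.
Qed.

Lemma le_double_c0 (m : nat) : (m <= c0 * N ^ 2 -> m <= 2 * c0 * N ^ 2)%N.
Proof. by move=> h; rewrite -mulnA mul2n -addnn (leq_trans h) ?leq_addr. Qed.

Lemma log_qlin_lt (i : 'I_N) : (absz_log (qlin i.+1) < W)%N.
Proof.
apply: log_lt; apply: le_double_c0; apply: leq_trans (qlin_le _) _ => //.
by rewrite leq_mul2l (leq_trans (ltn_ord i)) ?orbT // expnS expn1 leq_pmulr // (leq_trans _ (ltn_ord i)).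
Qed.

Lemma log_sqroot_lt (i : 'I_N) : (0 < qabs i.+1)%N ->
  (absz_log (sqroot_part (qabs i.+1)) < W)%N.
Proof.
move=> P0; apply: log_lt; apply: le_double_c0; apply: leq_trans (qabs_le_N i).
apply: leq_trans (dvdn_leq P0 (sqroot_part_dvd _)).
by rewrite expnS expn1 leq_pmulr ?sqroot_part_gt0.
Qed.

Lemma qval_sign (n : nat) : qval n = (-1) ^+ (qval n < 0)%R * (qabs n)%:Z.
Proof. by rewrite {1}[qval n]intEsign. Qed.

(** Completing the square gives an equation in [qlin] and the root [y] of the square part, to which
    [gap] applies with [K = disc]. Labels consist of three sign bits, two residues modulo [disc] and
    two binary logarithms. *)
Lemma card_sqfree_part_eq (D : nat) :
  (#|[set i : 'I_N | (0 < qabs i.+1)%N && (sqfree_part (qabs i.+1) == D)]|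
    <= 8 * `|disc| ^ 2 * W ^ 2)%N.
Proof.
pose d := `|disc|%N.
have d0 : (0 < d)%N by rewrite absz_gt0.
pose rt (i : 'I_N) := sqroot_part (qabs i.+1).
pose f (i : 'I_N) := ((qval i.+1 < 0, (0 < qlin i.+1, qlin i.+1 < 0)),
  ((i.+1 %% d, rt i %% d)%N, (absz_log (qlin i.+1), absz_log (rt i)))).
pose pr T U (A : seq T) (B : seq U) := [seq (x, y) | x <- A, y <- B].
pose I := iota 0.
have -> : (8 * d ^ 2 * W ^ 2)%N =
   size (pr _ _ (pr _ _ bools (pr _ _ bools bools)) (pr _ _ (pr _ _ (I d) (I d)) (pr _ _ (I W) (I W)))).
  by rewrite !size_allpairs !size_iota /= !mulnn mulnA.
apply: (@leq_card_label _ _ _ _ f); last first.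
  move=> i; rewrite inE => /andP[P0 _]; rewrite /pr /I.
  do ?apply: allpairs_f; rewrite ?mem_bools // mem_iota /= add0n ?ltn_pmod ?log_qlin_lt //.
  exact: log_sqroot_lt.
move=> i j; rewrite !inE => /andP[Pi /eqP Di] /andP[Pj /eqP Dj] [sg pX nX rn ry lX lY].
have y0 k : (0 < qabs k.+1)%N -> 0 < (sqroot_part (qabs k.+1))%:Z by move=> /sqroot_part_gt0.
have eqK k : sqfree_part (qabs k) = D ->
    1 * qlin k ^+ 2 - (4 * a * (-1) ^+ (qval k < 0)%R * D%:Z) * (sqroot_part (qabs k))%:Z ^+ 2 = disc.
  move=> Dk; have vE : qval k = (-1) ^+ (qval k < 0)%R * (D%:Z * (sqroot_part (qabs k))%:Z ^+ 2).
    by rewrite [LHS]qval_sign [in LHS](sqfree_partE (qabs k)) Dk PoszM -rmorphXn.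
  by rewrite -(qlin_sqr k) [qval k in RHS]vE; ring.
have D0 : (0 < D)%N by rewrite -Di sqfree_part_gt0.
suff [] : qlin i.+1 = qlin j.+1 /\ (rt i)%:Z = (rt j)%:Z.
  by move=> /qlin_inj [] /val_inj.
apply: (gap (al := 1) (be := 4 * a * (-1) ^+ (qval i.+1 < 0)%R * D%:Z) (K := disc)) => //.
- have D1 : D%:Z != 0 by rewrite eqz_nat -lt0n.
  by rewrite !mulf_eq0 signr_eq0 (negbTE a_neq0) (negbTE D1).
- by rewrite !y0.
- exact: eqK.
- by rewrite sg; exact: eqK.
(* The determinant is a combination of the differences of the roots and of the arguments, both
   divisible by [disc] thanks to the residues in the label. *)
have -> : qlin i.+1 * (rt j)%:Z - qlin j.+1 * (rt i)%:Z =
  - qlin i.+1 * ((rt i)%:Z - (rt j)%:Z) + 2 * a * (rt i)%:Z * (i.+1%:Z - j.+1%:Z).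
  by rewrite /qlin; ring.
by apply: rpredD; apply: dvdz_mull; apply: modn_eq_dvdz.
Qed.

(* For fixed [m1 - m2] there are few possible [s], and [s] determines [t]. Given [s] and
   [t], the pair [(qlin x, qlin y)] is the image of [(g1, g %/ g1)] under a linear map of
   determinant [2 * a * (m1 - m2)] up to sign, so congruent pairs [(g1, g %/ g1)] modulo
   [disc] give solutions of [qlin_pair_eq] whose determinant is a multiple of
   [disc * (m2 - m1)]. *)
Lemma qval_pair_param (x y g : nat) (m1 m2 : int) : (0 < g)%N ->
  qval x = g%:Z * m1 -> qval y = g%:Z * m2 ->
  let g1 := gcdn g `|x%:Z - y%:Z|%N in
  exists s t : int, [/\ x%:Z - y%:Z = g1%:Z * s,
    a * (x%:Z + y%:Z) + b = (g %/ g1)%:Z * t & s * t = m1 - m2].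
Proof.
move=> g0 qx qy g1.
have g10 : (0 < g1)%N by rewrite gcdn_gt0 g0.
have /dvdzP[s sE] : (g1%:Z %| x%:Z - y%:Z)%Z by rewrite dvdzE dvdn_gcdr.
have gE : g%:Z = (g %/ g1)%:Z * g1%:Z by rewrite -PoszM divnK // dvdn_gcdl.
have /dvdzP[t tE] : ((g %/ g1)%:Z %| a * (x%:Z + y%:Z) + b)%Z.
  rewrite dvdzE; apply: dvdn_div_gcd => //.
  rewrite -abszM -qval_sub qx qy -mulrBr abszM.
  by rewrite dvdn_mulr.
exists s, t; split; [by rewrite sE mulrC|by rewrite tE mulrC|].
have g0' : g%:Z != 0 by rewrite eqz_nat -lt0n.
apply: (mulfI g0'); rewrite mulrBr -qx -qy qval_sub sE tE gE.
by ring.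
Qed.

(** Eliminating [g] between the two completed squares produces an equation of the form treated by
    [gap]. *)
Lemma qlin_pair_eq (x y : nat) (m1 m2 g : int) :
  qval x = g * m1 -> qval y = g * m2 ->
  m2 * qlin x ^+ 2 - m1 * qlin y ^+ 2 = disc * (m2 - m1).
Proof.
move=> qx qy; have := qlin_sqr x; have := qlin_sqr y; rewrite qx qy.
move=> /eqP; rewrite subr_eq => /eqP -> /eqP; rewrite subr_eq => /eqP ->.
by ring.
Qed.

(** The common factor [g] with [qabs] equal to [g * m1] and [g * m2] is not a parameter;
    divisibility by [m1] and the proportion recover it. *)
Definition qpairs (m1 m2 : nat) : {set 'I_N * 'I_N} :=
  [set p : 'I_N * 'I_N | [&& p.1 != p.2, (0 < qabs p.1.+1)%N, (m1 %| qabs p.1.+1)%N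
    & (qabs p.2.+1 * m1 == qabs p.1.+1 * m2)%N]].

(** The degenerate case, where [K] would vanish: two distinct arguments with equal values have [a]
    times their sum equal to [- b], so the first is bounded and determines the second. *)
Lemma card_qpairs_eq (m1 m2 : nat) :
  (#|[set p in qpairs m1 m2 | qval p.1.+1 == qval p.2.+1]| <= `|b|)%N.
Proof.
rewrite -[`|b|%N](size_iota 0).
have key (p : 'I_N * 'I_N) : p \in [set p in qpairs m1 m2 | qval p.1.+1 == qval p.2.+1] ->
    a * (p.1.+1%:Z + p.2.+1%:Z) = - b.
  rewrite !inE => /andP[/and4P[p12 _ _ _]]; rewrite -subr_eq0 qval_sub mulf_eq0.
  rewrite subr_eq0 eqz_nat eqSS => /orP[/eqP/val_inj h|].
    by rewrite h eqxx in p12.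
  by rewrite addr_eq0 => /eqP.
apply: (@leq_card_label _ _ _ _ (fun p => val p.1)).
  move=> p q pS qS pq; have := key q qS; rewrite -(key p pS) => /(mulfI a_neq0).
  rewrite pq => /addrI []; move: pq; case: p {pS} => p1 p2; case: q {qS} => q1 q2 /=.
  by move=> /val_inj -> /val_inj ->.
move=> p pS; rewrite mem_iota /= add0n -abszN -(key p pS) abszM -PoszD /=.
rewrite (@leq_trans (p.1.+1 + p.2.+1)) // ?leq_addr //.
by rewrite leq_pmull // absz_gt0.
Qed.

(** A label has seven sign or order bits, the absolute value of [s], the residues of [g1] and [g2]
    modulo [disc], and two binary logarithms. *)
Lemma card_qpairs_neq (m1 m2 : nat) : (0 < m1)%N -> (0 < m2)%N ->
  (#|[set p in qpairs m1 m2 | qval p.1.+1 != qval p.2.+1]| <= 256 * `|disc| ^ 2 * W ^ 3)%N.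
Proof.
move=> m10 m20.
pose d := `|disc|%N.
have d0 : (0 < d)%N by rewrite absz_gt0.
set S := [set p in _ | _].
have [->|[p0 p0S]] := set_0Vmem S; first by rewrite cards0.
pose gg (p : 'I_N * 'I_N) := (qabs p.1.+1 %/ m1)%N.
have ggP p : p \in S -> [/\ (0 < gg p)%N, qabs p.1.+1 = (gg p * m1)%N & qabs p.2.+1 = (gg p * m2)%N].
  rewrite !inE => /andP[/and4P[_ P0 dv /eqP eq2] _].
  have P1E : qabs p.1.+1 = (gg p * m1)%N by rewrite divnK.
  split=> //; first by move: P0; rewrite P1E muln_gt0 => /andP[].
  by apply/eqP; rewrite -(eqn_pmul2r m10) eq2 P1E mulnAC.
have m12 : (m1 + m2 <= 2 * c0 * N ^ 2)%N.
  have [g0 e1 e2] := ggP _ p0S.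
  rewrite -mulnA mul2n -addnn leq_add //.
    by apply: leq_trans (qabs_le_N p0.1); rewrite e1 leq_pmull.
  by apply: leq_trans (qabs_le_N p0.2); rewrite e2 leq_pmull.
pose sg (n : nat) : int := (-1) ^+ (qval n < 0)%R.
pose mu1 (p : 'I_N * 'I_N) : int := sg p.1.+1 * m1%:Z.
pose mu2 (p : 'I_N * 'I_N) : int := sg p.2.+1 * m2%:Z.
have qv1 p : p \in S -> qval p.1.+1 = (gg p)%:Z * mu1 p.
  by move=> /ggP[_ e1 _]; rewrite qval_sign e1 PoszM /mu1 mulrCA.
have qv2 p : p \in S -> qval p.2.+1 = (gg p)%:Z * mu2 p.
  by move=> /ggP[_ _ e2]; rewrite qval_sign e2 PoszM /mu2 mulrCA.
have muN p : p \in S -> mu1 p - mu2 p != 0.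
  move=> pS; move: (pS); rewrite inE => /andP[_]; apply: contraNN.
  by rewrite subr_eq0 (qv1 p pS) (qv2 p pS) => /eqP ->.
pose g1 p := gcdn (gg p) `|p.1.+1%:Z - p.2.+1%:Z|%N.
pose g2 p := (gg p %/ g1 p)%N.
pose sa (p : 'I_N * 'I_N) := (`|p.1.+1%:Z - p.2.+1%:Z| %/ g1 p)%N.
have param p : p \in S -> exists s t : int, [/\ p.1.+1%:Z - p.2.+1%:Z = (g1 p)%:Z * s,
    a * (p.1.+1%:Z + p.2.+1%:Z) + b = (g2 p)%:Z * t & s * t = mu1 p - mu2 p].
  by move=> pS; have [g0 _ _] := ggP p pS; exact: qval_pair_param g0 (qv1 p pS) (qv2 p pS).
have g1_gt0 p : p \in S -> (0 < g1 p)%N.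
  by move=> pS; have [g0 _ _] := ggP p pS; rewrite gcdn_gt0 g0.
have saE p s : p \in S -> p.1.+1%:Z - p.2.+1%:Z = (g1 p)%:Z * s -> sa p = `|s|%N.
  by move=> pS e; rewrite /sa e abszM mulKn ?g1_gt0.
pose f (p : 'I_N * 'I_N) := (((qval p.1.+1 < 0, qval p.2.+1 < 0), ((0 < qlin p.1.+1, qlin p.1.+1 < 0),
   ((0 < qlin p.2.+1, qlin p.2.+1 < 0), (p.1 < p.2)%N))),
  ((sa p, (g1 p %% d, g2 p %% d)%N), (absz_log (qlin p.1.+1), absz_log (qlin p.2.+1)))).
pose pr T U (A : seq T) (B : seq U) := [seq (x, y) | x <- A, y <- B].
pose I := iota 0.
pose b2 := pr _ _ bools bools.
(* [s] divides the difference of the signed cofactors, which is [m1 + m2] or [m1 - m2] up to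
   sign. *)
pose dvs := divisors (m1 + m2) ++ divisors `|m1%:Z - m2%:Z|%N.
have szd : (size dvs <= 2 * W)%N.
  rewrite size_cat mul2n -addnn leq_add // divisors_le //.
  by apply: leq_trans m12; clear; lia.
apply: (@leq_trans (size (pr _ _ (pr _ _ b2 (pr _ _ b2 (pr _ _ b2 bools)))
   (pr _ _ (pr _ _ dvs (pr _ _ (I d) (I d))) (pr _ _ (I W) (I W)))))); last first.
  rewrite !size_allpairs !size_iota /= !mulnn.
  apply: (@leq_trans (128 * (2 * W * d ^ 2 * W ^ 2))); last first.
    by rewrite [X in (_ <= X)%N](_ : _ = 128 * (2 * W * d ^ 2 * W ^ 2))%N // /d; move: `|disc|%N => e; clear; ring.
  by rewrite leq_mul2l leq_mul2r leq_mul2r szd !orbT.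
apply: (@leq_card_label _ _ _ _ f); last first.
  move=> p pS; rewrite /pr /I /b2 /bools.
  do ?apply: allpairs_f; rewrite ?mem_bools // ?mem_iota /= ?add0n ?ltn_pmod ?log_qlin_lt //.
  have [s [t [e1 e2 e3]]] := param p pS.
  have : (sa p %| `|mu1 p - mu2 p|)%N by rewrite (saE p s pS e1) -e3 abszM dvdn_mulr.
  have := muN p pS; rewrite /mu1 /mu2 /sg mem_cat -absz_gt0.
  case: (qval _ < 0); case: (qval _ < 0); rewrite ?expr0 ?expr1 ?mul1r ?mulN1r => nz dv; apply/orP.
  - right; have e : `|(- m1%:Z - - m2%:Z)%R|%N = `|m1%:Z - m2%:Z|%N by clear; lia.
    by rewrite e in nz dv; rewrite -dvdn_divisors.
  - left; have e : `|(- m1%:Z - m2%:Z)%R|%N = (m1 + m2)%N by clear; lia.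
    by rewrite e in nz dv; rewrite -dvdn_divisors.
  - left; have e : `|(m1%:Z - - m2%:Z)%R|%N = (m1 + m2)%N by clear; lia.
    by rewrite e in nz dv; rewrite -dvdn_divisors.
  - by right; rewrite -dvdn_divisors.
move=> p q pS qS [s1 s2 pX1 nX1 pX2 nX2 lt12 saq r1 r2 l1 l2].
have mu1E : mu1 p = mu1 q by rewrite /mu1 /sg s1.
have mu2E : mu2 p = mu2 q by rewrite /mu2 /sg s2.
have [s [t [e1 e2 e3]]] := param p pS; have [s' [t' [e1' e2' e3']]] := param q qS.
(* The label [sa] fixes the absolute value of [s], and the order bit fixes its sign because [g1] is
   positive. *)
have ss' : s = s'.
  have : `|s|%N = `|s'|%N by rewrite -(saE p s pS e1) -(saE q s' qS e1').
  have : (s < 0) = (s' < 0).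
    rewrite -(@pmulr_rlt0 _ (g1 p)%:Z) ?ltz_nat ?g1_gt0 // -e1.
    rewrite -(@pmulr_rlt0 _ (g1 q)%:Z s') ?ltz_nat ?g1_gt0 // -e1'.
    by rewrite !subr_lt0 !ltz_nat !ltnS.
  by clear; lia.
have s0 : s != 0 by apply: contraNneq (muN p pS) => s0; rewrite -e3 s0 mul0r.
have tt' : t = t' by apply: (mulfI s0); rewrite e3 ss' e3' mu1E mu2E.
have X1E (r : 'I_N * 'I_N) u v : r.1.+1%:Z - r.2.+1%:Z = (g1 r)%:Z * u ->
    a * (r.1.+1%:Z + r.2.+1%:Z) + b = (g2 r)%:Z * v ->
   qlin r.1.+1 = (g2 r)%:Z * v + a * ((g1 r)%:Z * u) /\
   qlin r.2.+1 = (g2 r)%:Z * v - a * ((g1 r)%:Z * u).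
  by move=> <- <-; rewrite /qlin; split; ring.
have [x1p x2p] := X1E p s t e1 e2; have [x1q x2q] := X1E q s' t' e1' e2'.
suff [/qlin_inj/eqP e /qlin_inj/eqP e'] : qlin p.1.+1 = qlin q.1.+1 /\ qlin p.2.+1 = qlin q.2.+1.
  move: e e'; rewrite !eqSS => /eqP/val_inj e /eqP/val_inj e'.
  by rewrite [p]surjective_pairing [q]surjective_pairing e e'.
have m0 p' : p' \in S -> mu1 p' != 0 /\ mu2 p' != 0.
  by rewrite /mu1 /mu2 !mulf_eq0 !signr_eq0 /= !eqz_nat -!lt0n m10 m20.
apply: (gap (al := mu2 p) (be := mu1 p) (K := disc * (mu2 p - mu1 p))) => //.
- by case: (m0 p pS).
- by case: (m0 p pS).
- by rewrite mulf_neq0 // -opprB oppr_eq0 muN.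
- exact: qlin_pair_eq (qv1 p pS) (qv2 p pS).
- by rewrite mu1E mu2E; exact: qlin_pair_eq (qv1 q qS) (qv2 q qS).
(* The factor [mu2 p - mu1 p] arises as [- (s * t)]; the residues of [g1] and [g2] then supply
   [disc]. *)
have -> : qlin p.1.+1 * qlin q.2.+1 - qlin q.1.+1 * qlin p.2.+1 =
   2 * a * ((g1 q)%:Z * ((g2 p)%:Z - (g2 q)%:Z) - (g2 q)%:Z * ((g1 p)%:Z - (g1 q)%:Z)) * (mu2 p - mu1 p).
  rewrite x1p x2p x1q x2q -ss' -tt' -(opprB (mu1 p)) -e3; ring.
apply: dvdz_mul => //; apply: dvdz_mull; apply: rpredB; apply: dvdz_mull; exact: modn_eq_dvdz.
Qed.

Lemma card_qpairs (m1 m2 : nat) : (0 < m1)%N -> (0 < m2)%N -> (0 < W)%N ->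
  (#|qpairs m1 m2| <= (256 * `|disc| ^ 2 + `|b|) * W ^ 3)%N.
Proof.
move=> m10 m20 W0; rewrite -(cardsID [set p : 'I_N * 'I_N | qval p.1.+1 == qval p.2.+1]) addnC mulnDl.
apply: leq_add.
  apply: leq_trans (card_qpairs_neq m10 m20); apply: subset_leq_card.
  by apply/fintype.subsetP => p; rewrite !inE andbC.
apply: leq_trans (leq_trans (card_qpairs_eq m1 m2) (leq_pmulr _ _)); last by rewrite expn_gt0 W0.
by apply: subset_leq_card; apply/fintype.subsetP => p; rewrite !inE.
Qed.

(** * Dyadic classes of squarefree parts *)

Variable R : rcfType.
Definition core (i : 'I_N) : nat := sqfree_part (qabs i.+1).
Definition nonroot (i : 'I_N) : bool := (0 < qabs i.+1)%N.

Definition level_set (al e : nat) : {set 'I_N} :=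
  [set i | [&& nonroot i, trunc_log 2 (core i) == al & (e %| core i)%N]].

Lemma core_gt0 (i : 'I_N) : nonroot i -> (0 < core i)%N.
Proof. by move=> oki; exact: sqfree_part_gt0. Qed.

Lemma core_le (i : 'I_N) : nonroot i -> (core i <= c0 * N ^ 2)%N.
Proof.
move=> oki; apply: leq_trans (qabs_le_N i).
by apply: dvdn_leq => //; exact: sqfree_part_dvd.
Qed.

Lemma W_gt0 : (0 < W)%N.
Proof. by apply: leq_ltn_trans (log_lt (leq0n _)). Qed.

Lemma level_set_bounds al e i : i \in level_set al e ->
  [/\ nonroot i, (2 ^ al <= core i)%N, (core i < 2 ^ al.+1)%N & (e %| core i)%N].
Proof.
rewrite inE => /and3P[oki /eqP <- ei]; split => //.
  by rewrite trunc_logP // core_gt0.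
by rewrite trunc_log_ltn.
Qed.

(** The three factors are at least 1 and dominate the constants of the various counts below, so that
    a single [loss] serves for all of them. *)
Definition card_const : nat :=
  (256 * `|disc| ^ 2 + `|b| + 1) * (16 * c0 ^ 2 + 1) * (6 * kappa * c0 + kappa + 1).

Definition loss : R := (card_const * W ^ 3)%:R.

Lemma le_loss (k j : nat) : (k <= card_const)%N -> (j <= 3)%N -> (k * W ^ j)%:R <= loss.
Proof.
by move=> kC j3; rewrite ler_nat leq_mul // leq_pexp2l // W_gt0.
Qed.

(** The squarefree part is [k * e] with [k] at most [2 ^ al.+1 %/ e], and each value is taken by few
    indices. *)
Lemma card_level_set1 al e : (0 < e)%N ->
  #|level_set al e|%:R <= loss * (2 ^+ al / e%:R).
Proof.
move=> e0; have cnt : (#|level_set al e| <= 2 ^ al.+1 %/ e * (8 * `|disc| ^ 2 * W ^ 2))%N.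
  rewrite -[(2 ^ _ %/ e)%N](size_iota 1).
  apply: (@leq_card_union_const _ _ _ _ (fun i k => core i == k * e)%N).
    move=> i /level_set_bounds[oki _ ub /dvdnP[k kE]]; exists k; last by rewrite kE.
    rewrite mem_iota add1n ltnS leq_divRL // -kE; apply/andP; split; last exact: ltnW.
    by have := core_gt0 oki; rewrite kE muln_gt0 => /andP[].
  move=> k _; apply: leq_trans (card_sqfree_part_eq (k * e)); apply: subset_leq_card.
  apply/fintype.subsetP => i; rewrite !inE => /andP[/and3P[oki _ _] h].
  by apply/andP; split.
apply: (@le_trans _ _ (2 ^ al.+1 %/ e * (8 * `|disc| ^ 2 * W ^ 2))%:R); first by rewrite ler_nat.
have e0R : 0 < e%:R :> R by rewrite ltr0n.
have h1 : (2 ^ al.+1 %/ e)%:R <= 2 * (2 ^+ al / e%:R) :> R.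
  rewrite mulrA ler_pdivlMr // -exprS -natrX -natrM ler_nat.
  exact: leq_trunc_div.
rewrite natrM; apply: (le_trans (ler_wpM2r _ h1)) => //.
have -> : 2 * (2 ^+ al / e%:R) * (8 * `|disc| ^ 2 * W ^ 2)%:R =
    (16 * `|disc| ^ 2 * W ^ 2)%:R * (2 ^+ al / e%:R) :> R.
  by rewrite !natrM; ring.
apply: ler_wpM2r; first by rewrite divr_ge0 // exprn_ge0.
apply: le_loss => //; rewrite /card_const -mulnA.
apply: (@leq_trans (256 * `|disc| ^ 2 + `|b| + 1)); first by clear; lia.
by rewrite leq_pmulr // muln_gt0 !addn1.
Qed.

Lemma card_dvd_ok (m M : nat) : (0 < m)%N ->
  (#|[set i : 'I_N | [&& nonroot i, (i < M)%N & (m %| qabs i.+1)%N]]| <= W * (kappa * M %/ m).+1)%N.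
Proof.
move=> m0; set S := [set i | _].
(* An element of the set bounds [m] by a nonzero value of the quadratic; only then does [W] dominate
   the number of divisors of [m]. *)
have [->|[i iS]] := set_0Vmem S; first by rewrite cards0.
have mW : (size (divisors m) <= W)%N.
  move: iS; rewrite inE => /and3P[oki _ mi].
  by apply/divisors_le/le_double_c0/(leq_trans _ (qabs_le_N i))/dvdn_leq.
apply: leq_trans (leq_mul mW (leqnn _)); apply: leq_trans (card_dvd_qabs M N m0).
by apply: subset_leq_card; apply/fintype.subsetP => j; rewrite !inE => /and3P[_ -> ->].
Qed.

Lemma card_level_set3 al e : (0 < e)%N -> #|level_set al e|%:R <= loss * (N%:R / e%:R + 1).
Proof.
move=> e0; have cnt : (#|level_set al e| <= W * (kappa * N %/ e).+1)%N.
  apply: leq_trans (card_dvd_ok N e0); apply: subset_leq_card.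
  apply/fintype.subsetP => i /level_set_bounds[oki _ _ eD]; rewrite inE ltn_ord /=.
  by apply/andP; split=> //; apply: dvdn_trans eD (sqfree_part_dvd _).
apply: (@le_trans _ _ ((kappa * W ^ 1)%:R * (N%:R / e%:R + 1))); last first.
  apply: ler_wpM2r; first by rewrite addr_ge0 // divr_ge0.
  apply: le_loss => //; rewrite /card_const.
  apply: (@leq_trans (6 * kappa * c0 + kappa + 1)); first by clear; lia.
  by rewrite leq_pmull // muln_gt0 !addn1.
apply: (@le_trans _ _ (W * (kappa * N %/ e).+1)%:R); first by rewrite ler_nat.
have -> : (kappa * W ^ 1)%:R * (N%:R / e%:R + 1) = W%:R * (kappa%:R * (N%:R / e%:R + 1)) :> R.
  by rewrite expn1 natrM; ring.
rewrite natrM ler_wpM2l //.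
rewrite -natr1 mulrDr mulr1 lerD // ?ler1n ?kappa_gt0 //.
by apply: le_trans (ler_divn _ _ _) _; rewrite natrM mulrA.
Qed.

(* A natural number between [sqrt (2 ^ al)] and [2 * sqrt (2 ^ al)]. *)
Definition half_pow2 (al : nat) : nat := 2 ^ uphalf al.
Definition sqrt_pow2 (al : nat) : R := Num.sqrt (2 ^+ al).

Lemma half_pow2_ge al : (2 ^ al <= half_pow2 al ^ 2)%N.
Proof. by rewrite -expnM leq_exp2l // muln2; clear; lia. Qed.

Lemma half_pow2_le al : (half_pow2 al ^ 2 <= 2 ^ al.+1)%N.
Proof. by rewrite -expnM leq_exp2l // muln2; clear; lia. Qed.

Lemma sqrt_pow2_gt0 al : 0 < sqrt_pow2 al.
Proof. by rewrite sqrtr_gt0 exprn_gt0. Qed.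

Lemma sqr_sqrt_pow2 al : sqrt_pow2 al ^+ 2 = 2 ^+ al.
Proof. by rewrite sqr_sqrtr // exprn_ge0. Qed.

Lemma sqrt_pow2_le_half_pow2 al : sqrt_pow2 al <= (half_pow2 al)%:R.
Proof.
rewrite -(@ler_pXn2r _ 2) ?nnegrE ?(ltW (sqrt_pow2_gt0 _)) //.
by rewrite sqr_sqrt_pow2 -!natrX ler_nat half_pow2_ge.
Qed.

Lemma half_pow2_le_sqrt_pow2 al : (half_pow2 al)%:R <= 2 * sqrt_pow2 al.
Proof.
rewrite -(@ler_pXn2r _ 2) ?nnegrE ?mulr_ge0 ?(ltW (sqrt_pow2_gt0 _)) //.
rewrite exprMn sqr_sqrt_pow2; apply: (@le_trans _ _ (2 ^ al.+1)%:R).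
  by rewrite -natrX ler_nat half_pow2_le.
by rewrite natrX exprS ler_wpM2r ?exprn_ge0 // expr2 -natrM ler_nat.
Qed.

Lemma sqroot_le al e i : i \in level_set al e ->
  (0 < sqroot_part (qabs i.+1) <= 2 * c0 * N %/ half_pow2 al)%N.
Proof.
move=> /level_set_bounds[oki lb _ _]; rewrite sqroot_part_gt0 //=.
have r0 : (0 < half_pow2 al)%N by rewrite expn_gt0.
rewrite leq_divRL // -leq_sqr expnMn.
apply: (@leq_trans (sqroot_part (qabs i.+1) ^ 2 * (2 * core i))).
  by rewrite leq_mul2l (leq_trans (half_pow2_le al)) ?orbT // expnS leq_mul2l lb orbT.
rewrite mulnC -mulnA -sqfree_partE expnMn (leq_trans (leq_mul (leqnn 2) (qabs_le_N i))) //.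
by rewrite mulnA leq_mul2r expnMn (leq_mul (isT : 2 <= 2 ^ 2)%N) ?orbT //; case: (c0) => // k; rewrite expnS expn1 leq_pmulr.
Qed.

(** Sum over the root [y] of the square part. For given [y] the argument is at most a constant times
    [sqrt_pow2 al * y], and [e * y ^ 2] divides the value, so the congruence count is a term in
    [1 / y] plus [W]. The harmonic sum is logarithmic, and [y] runs up to a constant times
    [N / sqrt_pow2 al]. *)
Lemma card_level_set2 al e : (0 < e)%N ->
  #|level_set al e|%:R <= loss * (sqrt_pow2 al / e%:R + N%:R / sqrt_pow2 al).
Proof.
move=> e0; set Y := (2 * c0 * N %/ half_pow2 al)%N.
have cnt : (#|level_set al e| <=
    \sum_(y <- iota 1 Y) W * (kappa * (2 * c0 * half_pow2 al * y) %/ (e * y ^ 2)).+1)%N.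
  pose r (i : 'I_N) y := sqroot_part (qabs i.+1) == y.
  apply: (leq_trans (@leq_card_union _ _ _ (iota 1 Y) r _)).
    move=> i /sqroot_le iY; exists (sqroot_part (qabs i.+1)); last by rewrite /r.
    by rewrite mem_iota add1n ltnS.
  rewrite !big_seq; apply: leq_sum => y; rewrite mem_iota => /andP[y0 _].
  have ey0 : (0 < e * y ^ 2)%N by rewrite muln_gt0 e0 expn_gt0 y0.
  apply: leq_trans (card_dvd_ok _ ey0); apply: subset_leq_card; apply/fintype.subsetP => i.
  rewrite inE => /andP[/level_set_bounds[oki lb ub eD] /eqP yE].
  have qE : qabs i.+1 = (core i * y ^ 2)%N by rewrite -yE -sqfree_partE.
  rewrite inE; apply/and3P; split=> //; last by rewrite qE dvdn_mul.
  rewrite -leq_sqr; apply: (leq_trans (le_qabs _ oki)) => //.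
  rewrite qE mulnA expnMn leq_mul2r; apply/orP; right.
  rewrite expnMn expnMn.
  apply: (@leq_trans (c0 ^ 2 * (2 * half_pow2 al ^ 2))); last first.
    by rewrite mulnCA -mulnA (leq_mul (isT : 2 <= 2 ^ 2)%N).
  apply: leq_mul; first by case: (c0) => // k; rewrite expnS expn1 leq_pmulr.
  by rewrite (leq_trans (ltnW ub)) // expnS leq_mul2l half_pow2_ge.
have W1 : 1 <= W%:R :> R by rewrite ler1n W_gt0.
have s0 := sqrt_pow2_gt0 al; have eR : 0 < e%:R :> R by rewrite ltr0n.
(* The 6 leaves room for the 4 of the harmonic sum and the 2 of the number of [y]. *)
apply: (@le_trans _ _ (((6 * kappa * c0) * W ^ 2)%:R * (sqrt_pow2 al / e%:R + N%:R / sqrt_pow2 al))); last first.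
  apply: ler_wpM2r; first by rewrite addr_ge0 // divr_ge0 // ltW.
  apply: le_loss => //; rewrite /card_const.
  apply: (@leq_trans (6 * kappa * c0 + kappa + 1)); first by rewrite -addnA leq_addr.
  by rewrite leq_pmull // muln_gt0 !addn1.
apply: (@le_trans _ _ (\sum_(y <- iota 1 Y) W * (kappa * (2 * c0 * half_pow2 al * y) %/ (e * y ^ 2)).+1)%:R).
  by rewrite ler_nat.
rewrite natr_sum.
apply: (@le_trans _ _ (\sum_(y <- iota 1 Y) (W%:R * (4 * kappa * c0)%:R * (sqrt_pow2 al / e%:R) * y%:R^-1 + W%:R))).
  rewrite !big_seq; apply: ler_sum => y; rewrite mem_iota => /andP[y0 _].
  rewrite natrM -natr1 mulrDr mulr1 lerD2r -!mulrA ler_wpM2l //.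
  apply: (le_trans (ler_divn _ _ _)).
  have yR : 0 < y%:R :> R by rewrite ltr0n.
  rewrite ler_pdivrMr ?ltr0n ?muln_gt0 ?e0 ?expn_gt0 ?y0 //.
  rewrite !natrM.
  have -> : 4 * kappa%:R * c0%:R * (sqrt_pow2 al * (e%:R^-1 / y%:R)) * (e%:R * (y%:R * y%:R)) =
      kappa%:R * (2 * c0%:R * (2 * sqrt_pow2 al) * y%:R) :> R.
    by field; rewrite !gt_eqF.
  by rewrite ler_wpM2l // ler_wpM2r // ler_wpM2l ?mulr_ge0 //; exact: half_pow2_le_sqrt_pow2.
rewrite big_split /= -big_distrr /=.
have -> : \sum_(y <- iota 1 Y) W%:R = Y%:R * W%:R :> R.
  by rewrite big_const_seq count_predT size_iota iter_addr addr0 mulr_natl.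
have hY : Y%:R <= 2 * c0%:R * (N%:R / sqrt_pow2 al) :> R.
  apply: (le_trans (ler_divn _ _ _)); rewrite mulrA 2!natrM.
  have r0 : 0 < (half_pow2 al)%:R :> R by rewrite ltr0n expn_gt0.
  by rewrite ler_wpM2l ?mulr_ge0 // lef_pV2 ?posrE // sqrt_pow2_le_half_pow2.
have hH : \sum_(y <- iota 1 Y) y%:R^-1 <= W%:R :> R.
  apply: (le_trans (harmonic_le_log _ _)); rewrite ler_nat; apply: log_lt.
  apply: (leq_trans (leq_div _ _)).
  by rewrite leq_mul2l expnS expn1; apply/orP; right; case: (N) => // k; rewrite leq_pmulr.
have k1 : 1 <= kappa%:R :> R by rewrite ler1n kappa_gt0.
have q1 : 0 <= sqrt_pow2 al / e%:R by rewrite divr_ge0 // ltW.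
have q2 : 0 <= N%:R / sqrt_pow2 al by rewrite divr_ge0 // ltW.
move: hY hH q1 q2; move: (sqrt_pow2 al / _) (_ / sqrt_pow2 al) => x1 x2 hY hH q1 q2.
have c00 : 0 <= c0%:R :> R by [].
apply: (@le_trans _ _ (W%:R * (4 * kappa * c0)%:R * x1 * W%:R + 2 * c0%:R * x2 * W%:R)).
  apply: lerD; last by apply: ler_wpM2r.
  by apply: ler_wpM2l => //; rewrite !mulr_ge0.
rewrite !natrM -[W%:R * W%:R]expr2.
apply: (@le_trans _ _ (4 * kappa%:R * c0%:R * W%:R ^+ 2 * x1 + 2 * (kappa%:R * c0%:R * x2) * W%:R ^+ 2)).
  apply: lerD; first by rewrite le_eqVlt; apply/orP; left; apply/eqP; ring.
  apply: ler_pM; rewrite ?mulr_ge0 //.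
    rewrite -mulrA ler_wpM2l // -[leLHS]mul1r -mulrA ler_wpM2r ?mulr_ge0 //.
  by rewrite expr2 -[leLHS]mul1r ler_wpM2r.
rewrite -subr_ge0.
set z := (X in 0 <= X).
have -> : z = 2 * kappa%:R * c0%:R * W%:R ^+ 2 * x1 + 4 * kappa%:R * c0%:R * W%:R ^+ 2 * x2 by rewrite /z; ring.
by rewrite addr_ge0 // !mulr_ge0 // exprn_ge0.
Qed.

(** * Pairs and their continuations *)

Definition pair_set (al be ga : nat) : {set 'I_N * 'I_N} :=
  [set p : 'I_N * 'I_N | [&& p.1 != p.2, p.1 \in level_set al 1, p.2 \in level_set be 1
    & trunc_log 2 (gcdn (core p.1) (core p.2)) == ga]].

Lemma pair_set_gcd al be ga p : p \in pair_set al be ga ->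
  (2 ^ ga <= gcdn (core p.1) (core p.2) < 2 ^ ga.+1)%N.
Proof.
rewrite inE => /and4P[_ /level_set_bounds[ok1 _ _ _] _ /eqP <-].
by rewrite trunc_log_ltn // trunc_logP // gcdn_gt0 core_gt0.
Qed.

(** Choose the first index, then the gcd among the at most [W] divisors of its squarefree part; that
    gcd divides the squarefree part of the second index. *)
Lemma card_pair_set1 al be ga (k : R) :
  (forall e, (2 ^ ga <= e)%N -> #|level_set be e|%:R <= k) ->
  #|pair_set al be ga|%:R <= #|level_set al 1|%:R * (W%:R * k).
Proof.
move=> hk; have k0 : 0 <= k by apply: le_trans (hk _ (leqnn _)).
apply: ler_card_fibers => [p|x xS]; first by rewrite inE => /and4P[].
have [okx _ _ _] := level_set_bounds xS.
apply: (@le_trans _ _ ((size (divisors (core x)))%:R * k)); last first.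
  by apply: ler_wpM2r => //; rewrite ler_nat divisors_le // le_double_c0 // core_le.
pose r (y : 'I_N) g := gcdn (core x) (core y) == g.
apply: (@ler_card_union_const _ _ _ _ _ r) => [y _|g gD].
  by exists (gcdn (core x) (core y)); rewrite /r // -dvdn_divisors ?core_gt0 // dvdn_gcdl.
have [->|[y0 y0S]] := set_0Vmem [set y in [set y | (x, y) \in pair_set al be ga] | r y g].
  by rewrite cards0.
have gag : (2 ^ ga <= g)%N.
  by move: y0S; rewrite inE [_ \in [set _ | _]]inE => /andP[/pair_set_gcd /andP[h _] /eqP <-].
apply: le_trans (hk g gag); rewrite ler_nat; apply: subset_leq_card; apply/fintype.subsetP => y.
rewrite inE [_ \in [set _ | _]]inE => /andP[]; rewrite inE => /and4P[_ _ /= yS _] /eqP <-.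
by move: yS; rewrite !inE dvdn_gcdr => /and3P[-> -> _].
Qed.

(** This allows [card_pair_set1] to be used with the second index chosen first. *)
Lemma card_pair_set_sym al be ga : (#|pair_set al be ga| <= #|pair_set be al ga|)%N.
Proof.
apply: (@leq_card_inj _ _ _ _ (fun p => (p.2, p.1))).
  by move=> [x1 y1] [x2 y2] _ _ /= [-> ->].
by move=> [x y]; rewrite inE => /and4P[/= xy xS yS g]; rewrite inE /= eq_sym gcdnC xy xS yS.
Qed.

(** The two quotients [core / g] and the two roots of the square parts give the cofactors [m1] and
    [m2], which by [card_qpairs] leave few pairs. Multiplying the four ranges gives the bound. *)
Lemma card_pair_set2 al be ga :
  #|pair_set al be ga|%:R <= loss * (N%:R ^+ 2 * sqrt_pow2 al * sqrt_pow2 be / (2 ^+ ga) ^+ 2).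
Proof.
pose I k := iota 1 k.
pose pr T U (A : seq T) (B : seq U) := [seq (x, y) | x <- A, y <- B].
pose H k := (2 ^ k.+1 %/ 2 ^ ga)%N; pose Y k := (2 * c0 * N %/ half_pow2 k)%N.
pose B := pr _ _ (pr _ _ (I (H al)) (I (H be))) (pr _ _ (I (Y al)) (I (Y be))).
pose y (i : 'I_N) := sqroot_part (qabs i.+1).
pose r (p : 'I_N * 'I_N) (u : (nat * nat) * (nat * nat)) :=
  [&& p \in qpairs (u.1.1 * u.2.1 ^ 2) (u.1.2 * u.2.2 ^ 2), (0 < u.1.1 * u.2.1 ^ 2)%N
    & (0 < u.1.2 * u.2.2 ^ 2)%N].
have cov p : p \in pair_set al be ga -> exists2 u, u \in B & r p u.
  move=> pS; have /andP[g1 _] := pair_set_gcd pS; set g := gcdn _ _ in g1.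
  have g0 : (0 < g)%N by apply: leq_trans g1; rewrite expn_gt0.
  move: pS; rewrite inE => /and4P[p12 p1S p2S _].
  have [ok1 _ ub1 _] := level_set_bounds p1S; have [ok2 _ ub2 _] := level_set_bounds p2S.
  have hb i k : (g %| core i)%N -> nonroot i -> (core i < 2 ^ k.+1)%N -> ((core i %/ g)%N \in I (H k)).
    move=> gD oki ub; rewrite mem_iota add1n ltnS divn_gt0 // dvdn_leq ?core_gt0 //=.
    rewrite leq_divRL ?expn_gt0 //; apply: leq_trans (ltnW ub).
    by rewrite -[X in (_ <= X)%N](divnK gD) leq_mul2l g1 orbT.
  have yb i k : i \in level_set k 1 -> y i \in I (Y k).
    by move=> /sqroot_le h; rewrite mem_iota add1n ltnS.
  exists ((core p.1 %/ g, core p.2 %/ g), (y p.1, y p.2))%N.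
    by do 3?apply: allpairs_f; rewrite ?yb ?hb ?dvdn_gcdl ?dvdn_gcdr.
  have m_gt0 i : (g %| core i)%N -> nonroot i -> (0 < core i %/ g * y i ^ 2)%N.
    move=> gD oki; rewrite muln_gt0 divn_gt0 // dvdn_leq ?core_gt0 //=.
    by rewrite expn_gt0 sqroot_part_gt0.
  have qE i : (g %| core i)%N -> qabs i.+1 = (g * (core i %/ g * y i ^ 2))%N.
    by move=> gD; rewrite mulnA [(g * _)%N]mulnC divnK // -sqfree_partE.
  have [d1 d2] : (g %| core p.1)%N /\ (g %| core p.2)%N by rewrite dvdn_gcdl dvdn_gcdr.
  apply/and3P; split; [|exact: m_gt0|exact: m_gt0].
  rewrite inE; apply/and4P; split => //=; first by rewrite (qE _ d1) dvdn_mull.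
  by rewrite (qE _ d1) (qE _ d2) mulnAC.
have fib u : u \in B -> #|[set p in pair_set al be ga | r p u]|%:R <=
    ((256 * `|disc| ^ 2 + `|b|) * W ^ 3)%:R :> R.
  move=> _; rewrite ler_nat.
  have [->|[p0]] := set_0Vmem [set p in pair_set al be ga | r p u]; first by rewrite cards0.
  rewrite inE => /andP[_ /and3P[_ m10 m20]].
  apply: leq_trans (card_qpairs m10 m20 W_gt0); apply: subset_leq_card.
  by apply/fintype.subsetP => p; rewrite inE => /andP[_ /and3P[]].
apply: (le_trans (ler_card_union_const cov fib)).
have Gp : 0 < 2 ^+ ga :> R by rewrite exprn_gt0.
have Hle k : (H k)%:R <= 2 * sqrt_pow2 k ^+ 2 / 2 ^+ ga :> R.
  by apply: (le_trans (ler_divn _ _ _)); rewrite !natrX exprS sqr_sqrt_pow2.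
have Yle k : (Y k)%:R <= 2 * c0%:R * N%:R / sqrt_pow2 k :> R.
  apply: (le_trans (ler_divn _ _ _)); rewrite !natrM.
  by rewrite ler_wpM2l ?mulr_ge0 // lef_pV2 ?posrE ?sqrt_pow2_gt0 ?sqrt_pow2_le_half_pow2 // ltr0n expn_gt0.
have s0 := sqrt_pow2_gt0 al; have t0 := sqrt_pow2_gt0 be.
(* In [16 * c0 ^ 2] each of the four ranges contributes a 2, and each range of roots a [c0]. *)
apply: (@le_trans _ _ ((((256 * `|disc| ^ 2 + `|b|) * (16 * c0 ^ 2)) * W ^ 3)%:R *
   (N%:R ^+ 2 * sqrt_pow2 al * sqrt_pow2 be / (2 ^+ ga) ^+ 2))); last first.
  apply: ler_wpM2r; first by rewrite !mulr_ge0 ?invr_ge0 ?exprn_ge0 // ltW.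
  apply: le_loss => //; rewrite /card_const.
  apply: leq_trans (leq_pmulr _ _); last by rewrite !addn1.
  by apply: leq_mul; rewrite leq_addr.
rewrite !size_allpairs !size_iota.
apply: (@le_trans _ _ ((2 * sqrt_pow2 al ^+ 2 / 2 ^+ ga * (2 * sqrt_pow2 be ^+ 2 / 2 ^+ ga) *
   ((2 * c0%:R * N%:R / sqrt_pow2 al) * (2 * c0%:R * N%:R / sqrt_pow2 be))) * ((256 * `|disc| ^ 2 + `|b|) * W ^ 3)%:R)).
  apply: ler_wpM2r; first exact: ler0n.
  by rewrite !natrM; apply: ler_pM; rewrite ?mulr_ge0 //; apply: ler_pM.
rewrite le_eqVlt; apply/orP; left; apply/eqP.
rewrite !natrM; move: (256 * _ + _)%:R => t.
by field; rewrite !gt_eqF.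
Qed.

(* When [pair_core x] is the squarefree number [D_1 D_2 / g ^ 2], each of its prime
   factors divides exactly one of [D_1], [D_2], hence exactly one of [D_3], [D_4]. *)
Definition pair_core (x : 'I_N * 'I_N) : nat :=
  (core x.1 %/ gcdn (core x.1) (core x.2)) * (core x.2 %/ gcdn (core x.1) (core x.2)).

(** The level of [y.2] is left free, since the other three squarefree parts determine its own. *)
Definition tail_set (x : 'I_N * 'I_N) (de : nat) : {set 'I_N * 'I_N} :=
  [set y : 'I_N * 'I_N | [&& y.1 \in level_set de 1, nonroot y.2,
    sqfree_part (core x.1 * core x.2 * core y.1 * core y.2) == 1%N
    & (pair_core x <= gcdn (core y.1) (pair_core x) ^ 2)%N]].

(** Let [e] be the gcd of [core y.1] with [pair_core x], one of at most [W] divisors. The product of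
    the first two squarefree parts is [g ^ 2 * pair_core x], hence at most [(g * e) ^ 2] with
    [g < 2 * 2 ^ ga]: this is the condition on [e]. Finally [y.1] determines [core y.2], which
    leaves few [y.2]. *)
Lemma card_tail_set al be ga de x (k : R) : x \in pair_set al be ga ->
  (forall e, (2 ^ al * 2 ^ be <= (2 * 2 ^ ga * e) ^ 2)%N -> #|level_set de e|%:R <= k) ->
  #|tail_set x de|%:R <= W%:R * (k * loss).
Proof.
move=> xS hk; have /andP[_ gub] := pair_set_gcd xS; set g := gcdn _ _ in gub.
move: (xS); rewrite inE => /and4P[_ /level_set_bounds[ok1 lb1 _ _] /level_set_bounds[ok2 lb2 _ _] _].
have D1 := core_gt0 ok1; have D2 := core_gt0 ok2.
have g0 : (0 < g)%N by rewrite gcdn_gt0 D1.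
have gD1 : (g %| core x.1)%N := dvdn_gcdl _ _; have gD2 : (g %| core x.2)%N := dvdn_gcdr _ _.
have Q0 : (0 < pair_core x)%N by rewrite muln_gt0 !divn_gt0 // (dvdn_leq D1 gD1) (dvdn_leq D2 gD2).
(* A large enough [e] satisfies the condition, so [k] bounds some cardinal. *)
have k0 : 0 <= k.
  have h := hk (2 ^ al * 2 ^ be)%N; apply: le_trans (h _) => //.
  by rewrite leq_sqr_mul // muln_gt0 expn_gt0.
have divQ : (size (divisors (pair_core x)) <= W)%N.
  (* The squared range of [divisors_le_W] serves here: [pair_core x] is a product of two factors of
     size up to [c0 * N ^ 2]. *)
  apply: divisors_le_W; rewrite expnS expn1; apply: leq_mul.
    by apply: (leq_trans (leq_div _ _)); apply/le_double_c0/core_le.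
  by apply: (leq_trans (leq_div _ _)); apply/le_double_c0/core_le.
apply: (@le_trans _ _ ((size (divisors (pair_core x)))%:R * (k * loss))); last first.
  by apply: ler_wpM2r; rewrite ?mulr_ge0 // ler_nat.
pose r (y : 'I_N * 'I_N) e := gcdn (core y.1) (pair_core x) == e.
apply: (@ler_card_union_const _ _ _ _ _ r) => [y _|e _].
  by exists (gcdn (core y.1) (pair_core x)); rewrite /r // -dvdn_divisors // dvdn_gcdr.
set F := [set y in _ | _].
have [->|[y0]] := set_0Vmem F; first by rewrite cards0 mulr_ge0.
rewrite inE => /andP[]; rewrite inE => /and4P[_ _ _ Qe] /eqP y0e; rewrite y0e in Qe.
have {}hk : #|level_set de e|%:R <= k.
  apply: hk; apply: (@leq_trans (core x.1 * core x.2)); first exact: leq_mul.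
  rewrite -(divnK gD1) -(divnK gD2) mulnACA -/g -/(pair_core x) -expnS mulnC.
  by rewrite expnMn leq_mul // mulnn leq_exp2r // ltnW.
apply: (@le_trans _ _ (#|level_set de e|%:R * loss)); last by apply: ler_wpM2r.
apply: ler_card_fibers => [y|y1 _].
  rewrite inE => /andP[]; rewrite inE => /and4P[y1S _ _ _] /eqP <-.
  by move: y1S; rewrite !inE dvdn_gcdl => /and3P[-> -> _].
set F1 := [set y | _].
have [->|[y2]] := set_0Vmem F1; first by rewrite cards0.
have F1P y : y \in F1 -> [/\ nonroot y1, nonroot y & sqfree_part (core x.1 * core x.2 * core y1 * core y) = 1%N].
  rewrite inE inE => /andP[]; rewrite inE => /and4P[/= /level_set_bounds[okz _ _ _] oky /eqP sqy _] _.
  by [].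
move=> /F1P[oky1 oky2 sq2].
apply: (@le_trans _ _ (8 * `|disc| ^ 2 * W ^ 2)%:R).
  rewrite ler_nat; apply: leq_trans (card_sqfree_part_eq (core y2)); apply: subset_leq_card.
  apply/fintype.subsetP => y /F1P[_ oky sqy]; rewrite inE; apply/andP; split=> //; apply/eqP.
  apply: (@eqn_sqfree_part_mul (core x.1 * core x.2 * core y1)); [|exact: sqfree_partP|exact: sqfree_partP| |] => //.
  by rewrite !muln_gt0 D1 D2 core_gt0.
apply: le_loss => //; rewrite /card_const -mulnA.
apply: (@leq_trans (256 * `|disc| ^ 2 + `|b| + 1)); first by clear; lia.
by rewrite leq_pmulr // muln_gt0 !addn1.
Qed.

(** * Quadruples in one dyadic class *)

Definition quad_set (al be de ga : nat) : {set ('I_N * 'I_N) * ('I_N * 'I_N)} :=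
  [set q : ('I_N * 'I_N) * ('I_N * 'I_N) | [&& q.1 \in pair_set al be ga,
     q.2 \in tail_set q.1 de, (core q.1.2 <= core q.1.1)%N, (core q.2.1 <= core q.1.1)%N
   & (core q.1.1 <= gcdn (core q.1.1) (core q.1.2) ^ 3)%N]].

(** This is [exponent_bound] with [s ^+ 2 = N]. Pairs and continuations each carry [loss ^+ 3]. *)
Lemma card_quad_set al be de ga :
  #|quad_set al be de ga|%:R <= 16 * c0%:R * (Num.sqrt N%:R) ^+ 3 * loss ^+ 6.
Proof.
set s := Num.sqrt N%:R.
have L1 : 1 <= loss.
  rewrite -[1]/(1%:R) ler_nat muln_gt0 expn_gt0 W_gt0 andbT /card_const.
  by rewrite !muln_gt0 !addn1.
have L0 : 0 < loss by apply: lt_le_trans L1.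
have WL : W%:R <= loss.
  by have := @le_loss 1 1; rewrite mul1n expn1; apply=> //; rewrite /card_const !muln_gt0 !addn1.
(* An element of the set provides the inequalities between the dyadic exponents. *)
have [->|[q0 q0S]] := set_0Vmem (quad_set al be de ga).
  by rewrite cards0 !mulr_ge0 ?exprn_ge0 ?sqrtr_ge0 // ltW.
have N0 : (0 < N)%N by apply: leq_ltn_trans (ltn_ord q0.1.1).
have sN : s ^+ 2 = N%:R by rewrite sqr_sqrtr.
have s1 : 1 <= s.
  by rewrite -(@ler_pXn2r _ 2) ?nnegrE ?sqrtr_ge0 // sN expr1n ler1n.
have [D21 D31 pS tS Dg] : [/\ (core q0.1.2 <= core q0.1.1)%N, (core q0.2.1 <= core q0.1.1)%N,
   q0.1 \in pair_set al be ga, q0.2 \in tail_set q0.1 de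
   & (core q0.1.1 <= gcdn (core q0.1.1) (core q0.1.2) ^ 3)%N].
  by move: q0S; rewrite inE => /and5P[].
have /andP[_ gub] := pair_set_gcd pS.
move: (pS); rewrite inE => /and4P[_ S1 S2 /eqP gaE].
have S3 : q0.2.1 \in level_set de 1 by move: tS; rewrite inE => /and4P[].
have lv al' (i : 'I_N) : i \in level_set al' 1 -> trunc_log 2 (core i) = al'.
  by rewrite inE => /and3P[_ /eqP].
have [ok1 lb1 _ _] := level_set_bounds S1; have [ok2 lb2 _ _] := level_set_bounds S2.
have beal : (be <= al)%N by rewrite -(lv _ _ S1) -(lv _ _ S2) leq_trunc_log.
have deal : (de <= al)%N by rewrite -(lv _ _ S1) -(lv _ _ S3) leq_trunc_log.
have gabe : (ga <= be)%N.
  by rewrite -gaE -(lv _ _ S2) leq_trunc_log // dvdn_leq ?core_gt0 // dvdn_gcdr.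
have sq_mono k j : (k <= j)%N -> sqrt_pow2 k <= sqrt_pow2 j.
  by move=> kj; rewrite ler_wsqrtr // ler_weXn2l // ler1n.
have c01 : 1 <= c0%:R :> R.
  by rewrite ler1n; have := leq_trans (core_gt0 ok1) (core_le ok1); rewrite muln_gt0 => /andP[].
(* The number of continuations depends on the pair, so its maximum plays the role of [w]. *)
pose w := \max_(x in pair_set al be ga) #|tail_set x de|.
have hpw : #|quad_set al be de ga|%:R <= #|pair_set al be ga|%:R * w%:R :> R.
  apply: ler_card_fibers => [q|x xS]; first by rewrite inE => /and5P[].
  rewrite ler_nat; apply: leq_trans (leq_bigmax_cond (F := fun x => #|tail_set x de|) _ xS).
  by apply: subset_leq_card; apply/fintype.subsetP => y; rewrite inE inE => /and5P[].
have G0 : 0 < 2 ^+ ga :> R by rewrite exprn_gt0.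
have x0 := sqrt_pow2_gt0 al; have y0 := sqrt_pow2_gt0 be; have z0 := sqrt_pow2_gt0 de.
have hw (k : R) : (forall e, (2 ^ al * 2 ^ be <= (2 * 2 ^ ga * e) ^ 2)%N ->
     #|level_set de e|%:R <= loss * k) -> w%:R / loss ^+ 3 <= k.
  move=> hk; have pair_gt0 : (0 < #|pair_set al be ga|)%N by apply/card_gt0P; exists q0.1.
  have [x xS wE] := eq_bigmax_cond (fun x => #|tail_set x de|) pair_gt0.
  have k0 : 0 <= loss * k.
    apply: le_trans (hk (2 ^ al * 2 ^ be)%N _) => //.
    by rewrite leq_sqr_mul // muln_gt0 expn_gt0.
  rewrite ler_pdivrMr ?exprn_gt0 // [w]wE; apply: (le_trans (card_tail_set xS hk)).
  have -> : k * loss ^+ 3 = loss * (loss * k * loss) by ring.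
  by apply: ler_wpM2r => //; rewrite mulr_ge0 // ltW.
have eP e : (2 ^ al * 2 ^ be <= (2 * 2 ^ ga * e) ^ 2)%N ->
    (0 < e)%N /\ e%:R^-1 <= 2 * 2 ^+ ga / (sqrt_pow2 al * sqrt_pow2 be) :> R.
  move=> he; have e0 : (0 < e)%N.
    by case: e he => //; rewrite muln0 exp0n // leqn0 muln_eq0 !expn_eq0.
  split=> //; rewrite -[leLHS]mul1r ler_pdivrMr ?ltr0n // mulrAC ler_pdivlMr ?mulr_gt0 // mul1r.
  rewrite -(@ler_pXn2r _ 2) ?nnegrE ?mulr_ge0 ?exprn_ge0 ?(ltW x0) ?(ltW y0) //.
  rewrite exprMn !sqr_sqrt_pow2 -!natrX -!natrM -natrX ler_nat.
  exact: he.
have hp (al' be' : nat) (u v : R) : (#|pair_set al be ga| <= #|pair_set al' be' ga|)%N ->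
    0 <= v -> 0 <= u ->
    #|level_set al' 1|%:R <= loss * u ->
    (forall e, (2 ^ ga <= e)%N -> #|level_set be' e|%:R <= loss * v) ->
    #|pair_set al be ga|%:R / loss ^+ 3 <= u * v.
  move=> hs v0 u0 hu hv; rewrite ler_pdivrMr ?exprn_gt0 //.
  apply: (@le_trans _ _ #|pair_set al' be' ga|%:R); first by rewrite ler_nat.
  apply: (le_trans (card_pair_set1 _ hv)).
  have -> : u * v * loss ^+ 3 = (loss * u) * (loss * (loss * v)) by ring.
  apply: ler_pM => //; rewrite ?mulr_ge0 ?(ltW L0) //.
  by apply: ler_wpM2r => //; rewrite mulr_ge0 // ltW.
have invG e : (2 ^ ga <= e)%N -> (0 < e)%N /\ e%:R^-1 <= (2 ^+ ga)^-1 :> R.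
  move=> ge; have e0 : (0 < e)%N by apply: leq_trans ge; rewrite expn_gt0.
  by split=> //; rewrite lef_pV2 ?posrE ?ltr0n // -natrX ler_nat.
have hS1 al' : #|level_set al' 1|%:R <= loss * (sqrt_pow2 al' + s ^+ 2 / sqrt_pow2 al').
  by apply: (le_trans (card_level_set2 _ _)) => //; rewrite divr1 sN.
have nn (t : R) : 0 < t -> 0 <= t + s ^+ 2 / t.
  by move=> t0; rewrite addr_ge0 ?divr_ge0 ?exprn_ge0 ?sqrtr_ge0 // ltW.
have nG : 0 <= s ^+ 2 / 2 ^+ ga + 1.
  by rewrite addr_ge0 ?divr_ge0 ?exprn_ge0 ?sqrtr_ge0 // ltW.
have Lw := ler_wpM2l (ltW L0).
have hG3 be' e : (2 ^ ga <= e)%N -> #|level_set be' e|%:R <= loss * (s ^+ 2 / 2 ^+ ga + 1).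
  move=> /invG[e0 ie]; apply: (le_trans (card_level_set3 _ e0)); apply: Lw.
  by rewrite sN lerD2r ler_wpM2l.
have := @exponent_bound R c0%:R s (sqrt_pow2 al) (sqrt_pow2 be) (sqrt_pow2 de) (2 ^+ ga)
  (#|pair_set al be ga|%:R / loss ^+ 3) (w%:R / loss ^+ 3).
have -> : #|pair_set al be ga|%:R / loss ^+ 3 * (w%:R / loss ^+ 3) = #|pair_set al be ga|%:R * w%:R / loss ^+ 6.
  by rewrite mulf_div -exprD.
move=> h; apply: (le_trans hpw); rewrite -ler_pdivrMr ?exprn_gt0 //; apply: h => //.
- by rewrite divr_ge0 // exprn_ge0 // ltW.
- by rewrite divr_ge0 // exprn_ge0 // ltW.
- exact: sq_mono.
- exact: sq_mono.
- rewrite sqr_sqrt_pow2 (exprM _ 2 2) sN -!natrX -natrM ler_nat.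
  exact: leq_trans lb1 (core_le ok1).
- rewrite sqr_sqrt_pow2 -!natrX -natrM ler_nat; apply: (leq_trans lb1); apply: (leq_trans Dg).
  (* The 8 is the cube of the 2 lost in rounding the gcd down to a power of 2. *)
  have -> : (8 * (2 ^ ga) ^ 3 = (2 ^ ga.+1) ^ 3)%N by rewrite (expnS 2 ga) expnMn.
  by rewrite leq_exp2r // ltnW.
- by rewrite sqr_sqrt_pow2 ler_weXn2l // ler1n.
- apply: (hp _ _ _ _ (leqnn _) _ (nn _ x0) (hS1 al)); first by rewrite divr_ge0 ?exprn_ge0 // ltW.
  move=> e /invG[e0 ie]; apply: (le_trans (card_level_set1 _ e0)); apply: Lw.
  by rewrite sqr_sqrt_pow2 ler_wpM2l // exprn_ge0.
- exact: hp (leqnn _) nG (nn _ x0) (hS1 al) (hG3 be).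
- exact: hp (card_pair_set_sym _ _ _) nG (nn _ y0) (hS1 be) (hG3 al).
- rewrite ler_pdivrMr ?exprn_gt0 //; apply: (le_trans (card_pair_set2 _ _ _)).
  rewrite (exprM _ 2 2) sN mulrC; apply: ler_wpM2l; first by rewrite !mulr_ge0 ?invr_ge0 ?exprn_ge0 // ltW.
  by rewrite -[leLHS]expr1 ler_weXn2l.
- apply: hw => e /eP[e0 ie]; apply: (le_trans (card_level_set1 _ e0)); apply: Lw.
  by rewrite -sqr_sqrt_pow2 [leRHS]mulrAC [leRHS]mulrC ler_wpM2l // exprn_ge0 // ltW.
- apply: hw => e /eP[e0 ie]; apply: (le_trans (card_level_set2 _ e0)); apply: Lw.
  by rewrite sN lerD2r [leRHS]mulrAC [leRHS]mulrC ler_wpM2l // ltW.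
- apply: hw => e /eP[e0 ie]; apply: (le_trans (card_level_set3 _ e0)); apply: Lw.
  by rewrite sN lerD2r [leRHS]mulrAC [leRHS]mulrC ler_wpM2l.
Qed.

(** * Sorting a tuple into a dyadic class *)

Definition quad_ordered (x0 x1 x2 x3 : 'I_N) : Prop :=
  [/\ (core x1 <= core x0)%N, (core x2 <= core x0)%N, (core x0 <= gcdn (core x0) (core x1) ^ 3)%N,
    (pair_core (x0, x1) <= gcdn (core x2) (pair_core (x0, x1)) ^ 2)%N
  & sqfree_part (core x0 * core x1 * core x2 * core x3) = 1%N].

(** [i] maximizes the squarefree part, [j] comes from [leq_gcd_cube], and [leq_gcd_core] decides
    which remaining index comes third. *)
Lemma exists_ordering (n : {ffun 'I_4 -> 'I_N}) (z : nat) :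
  (forall i, nonroot (n i)) -> (\prod_i core (n i) = z ^ 2)%N ->
  exists i j k l : 'I_4, uniq [:: i; j; k; l] /\ quad_ordered (n i) (n j) (n k) (n l).
Proof.
move=> okn prodE.
have Dn i : (0 < core (n i))%N by exact: core_gt0.
have sf i : squarefree (core (n i)) by exact: sqfree_partP (okn i).
have z0 : (0 < z)%N.
  have : (0 < z ^ 2)%N by rewrite -prodE; apply: prodn_gt0 => t; exact: Dn.
  by rewrite expn_gt0 orbF.
pose i := [arg max_(i > ord0) core (n i)].
have imax t : (core (n t) <= core (n i))%N by rewrite /i; case: arg_maxnP => // u _; apply.
have prod_uniq j k l : uniq [:: i; j; k; l] -> (core (n i) * core (n j) * core (n k) * core (n l) = z ^ 2)%N.
  by move=> u; rewrite -prodE (prod_ord4 _ u).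
have [j [ij gj]] : exists j, i != j /\ (core (n i) <= gcdn (core (n i)) (core (n j)) ^ 3)%N.
  have [j0 ij0] := ord4_neq i.
  have [k0 [l0 u]] := ord4_complete ij0.
  have := leq_gcd_cube (sf i) (sf j0) (Dn k0) (Dn l0) (prod_uniq _ _ _ u).
  move: u; rewrite /= !inE !negb_or => /and4P[/and3P[_ ik0 il0] _ _ _].
  by case=> [|[|]] h; [exists j0|exists k0|exists l0].
have [k [l u]] := ord4_complete ij.
have u' : uniq [:: i; j; l; k].
  by move: u; rewrite /= !inE !negb_or !andbT (eq_sym l) => /and3P[/and3P[-> -> ->] /andP[-> ->] ->].
have sq1 k' l' : uniq [:: i; j; k'; l'] -> sqfree_part (core (n i) * core (n j) * core (n k') * core (n l')) = 1%N.
  by move=> v; rewrite (prod_uniq _ _ _ v) sqfree_part_sqr.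
have [h|h] := leq_gcd_core (sf i) (sf j) (Dn k) (Dn l) (prod_uniq _ _ _ u).
  by exists i, j, k, l; split=> //; split=> //; exact: sq1.
by exists i, j, l, k; split=> //; split=> //; exact: sq1.
Qed.

(** A tuple is labelled by an ordering, among [4 ^ 4 = 256] lists of indices, and by four binary
    logarithms below [W]. Once the ordering is fixed, the quadruple determines the tuple. *)
Lemma card_square_tuples (S : {set {ffun 'I_4 -> 'I_N}}) :
  (forall n, n \in S -> [/\ forall i, nonroot (n i), exists z, (\prod_i core (n i) = z ^ 2)%N
     & injective n]) ->
  #|S|%:R <= (256 * W ^ 4)%:R * (16 * c0%:R * (Num.sqrt N%:R) ^+ 3 * loss ^+ 6).
Proof.
move=> hS.
pose I := iota 0 W.
pose pr T U (A : seq T) (B : seq U) := [seq (x, y) | x <- A, y <- B].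
pose E := enum 'I_4.
pose B := pr _ _ (pr _ _ (pr _ _ E E) (pr _ _ E E)) (pr _ _ (pr _ _ I I) (pr _ _ I I)).
pose q (n : {ffun 'I_4 -> 'I_N}) (u : ('I_4 * 'I_4) * ('I_4 * 'I_4)) :=
  ((n u.1.1, n u.1.2), (n u.2.1, n u.2.2)).
pose r (n : {ffun 'I_4 -> 'I_N}) (v : (('I_4 * 'I_4) * ('I_4 * 'I_4)) * ((nat * nat) * (nat * nat))) :=
  uniq [:: v.1.1.1; v.1.1.2; v.1.2.1; v.1.2.2] &&
  (q n v.1 \in quad_set v.2.1.1 v.2.1.2 v.2.2.1 v.2.2.2).
have -> : (256 * W ^ 4)%N = size B.
  rewrite !size_allpairs !size_iota size_enum_ord (expnD _ 2 2) !expnS expn0 !muln1.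
  by rewrite !mulnA.
apply: (@ler_card_union_const _ _ _ _ _ r) => [n nS|v _].
  have [okn [z prodE] inj] := hS n nS.
  have [i [j [k [l [u [Dj Dk Dg Dc Dsq]]]]]] := exists_ordering okn prodE.
  have lv x : nonroot x -> trunc_log 2 (core x) \in I.
    by move=> okx; rewrite mem_iota /= add0n log_lt // le_double_c0 // core_le.
  exists (((i, j), (k, l)), ((trunc_log 2 (core (n i)), trunc_log 2 (core (n j))),
     (trunc_log 2 (core (n k)), trunc_log 2 (gcdn (core (n i)) (core (n j)))))).
    do 4?apply: allpairs_f; rewrite ?mem_enum ?lv //.
    rewrite mem_iota /= add0n log_lt // le_double_c0 //.
    by apply: leq_trans (core_le (okn i)); rewrite dvdn_leq ?core_gt0 // dvdn_gcdl.
  apply/andP; split=> //; rewrite inE; apply/and5P; split=> //.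
    rewrite inE; apply/and4P; split=> //.
    - rewrite (inj_eq inj); move: u; rewrite /= !inE !negb_or.
      by case/andP => /and3P[].
    - by rewrite inE eqxx dvd1n !andbT; exact: okn.
    - by rewrite inE eqxx dvd1n !andbT; exact: okn.
  rewrite inE; apply/and4P; split=> //; last by apply/eqP.
    by rewrite inE eqxx dvd1n !andbT; exact: okn.
  exact: okn.
apply: le_trans (card_quad_set v.2.1.1 v.2.1.2 v.2.2.1 v.2.2.2); rewrite ler_nat.
have [->|[n0]] := set_0Vmem [set n in S | r n v]; first by rewrite cards0.
rewrite inE => /andP[_ /andP[u _]].
apply: (@leq_card_inj _ _ _ _ (fun n => q n v.1)); last by move=> n; rewrite inE => /andP[_ /andP[]].
move=> n m _ _ [e1 e2 e3 e4]; apply/ffunP => t.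
have : t \in [:: v.1.1.1; v.1.1.2; v.1.2.1; v.1.2.2].
  by rewrite (perm_mem (perm_eq_enum_ord4 u)) mem_enum.
by rewrite !inE => /or4P[] /eqP ->.
Qed.

End Quadratic.

(** * Subpolynomial factors and conclusion *)

(** [W] is the maximum of both functions over the range; [divisor_bound] and [trunc_log_bound]
    control its [k]-th power for [k] as large as desired. *)
Lemma subpolynomial_witness (R : realType) (e : R) (c0 t : nat) : 0 < e ->
  exists2 C : R, 0 < C & forall N : nat, (0 < N)%N -> exists W : nat,
    [/\ forall m : nat, (m <= (2 * c0 * N ^ 2) ^ 2)%N -> (size (divisors m) <= W)%N,
        forall m : nat, (m <= (2 * c0 * N ^ 2) ^ 2)%N -> (trunc_log 2 m < W)%N
      & (W ^ t)%:R <= C * N%:R `^ e].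
Proof.
(* The range of [m] ends at a constant times [N ^ 4], and [4 / e < j] makes the [j]-th root of
   [N ^ 4] at most [N] to the power [e]. Using [t.+1] keeps [k] positive, and still [t * j <= k]. *)
move=> e0; pose j := (Num.truncn (4 / e)).+1; pose k := (t.+1 * j)%N.
have k0 : (0 < k)%N by rewrite muln_gt0.
have je : 4 / e < j%:R by exact: truncnS_gt.
have j0 : 0 < j%:R :> R by rewrite ltr0n.
pose K := ((k ^ k) ^ (2 ^ k) * ((2 * c0) ^ 2 + 1))%N.
have K0 : (0 < K)%N by rewrite muln_gt0 !expn_gt0 k0 addn1.
exists (K%:R `^ j%:R^-1); first by rewrite powR_gt0 // ltr0n.
move=> N N0; pose M := ((2 * c0 * N ^ 2) ^ 2)%N.
pose F (m : 'I_M.+1) := maxn (size (divisors m)) (trunc_log 2 m).+1.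
exists (\max_m F m).
have Fm (m : nat) : (m <= M)%N -> (maxn (size (divisors m)) (trunc_log 2 m).+1 <= \max_m F m)%N.
  by rewrite -ltnS => mM; exact: (leq_bigmax (Ordinal mM)).
split=> [m /Fm|m /Fm|]; rewrite ?geq_max; [by case/andP|by case/andP|].
set W := (\max_m F m)%N.
have Wk : (W ^ k <= K * N ^ 4)%N.
  have [m _ WE] : {m | m \in 'I_M.+1 & W = F m} by apply: eq_bigmax_cond; rewrite card_ord.
  rewrite WE; have [m0|m0] := posnP m.
    by rewrite /F m0 /= trunc_log0 exp1n muln_gt0 K0 expn_gt0 N0.
  apply: (@leq_trans ((k ^ k) ^ (2 ^ k) * m)).
    rewrite /F /maxn; case: ifP => _; last exact: divisor_bound.
    apply: (leq_trans (trunc_log_bound k0 m0)); rewrite leq_mul2r; apply/orP; right.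
    by rewrite -[X in (X <= _)%N]expn1 leq_pexp2l ?expn_gt0 ?k0.
  rewrite /K -mulnA leq_mul2l; apply/orP; right.
  apply: (@leq_trans M); first by rewrite -ltnS ltn_ord.
  by rewrite /M expnMn -expnM leq_mul2r leq_addr orbT.
pose V : R := (W ^ t)%:R.
have V0 : 0 <= V by [].
have Vj : V ^+ j <= K%:R * N%:R ^+ 4.
  rewrite -!natrX -natrM ler_nat; apply: leq_trans Wk; rewrite -expnM.
  have W0 : (0 < W)%N.
    by apply: leq_trans (Fm 0%N _) => //; rewrite leq_max ltn0Sn orbT.
  by rewrite leq_pexp2l // /k leq_mul2r leqnSn orbT.
have -> : (W ^ t)%:R = (V ^+ j) `^ j%:R^-1.
  by rewrite -powR_mulrn // -powRrM mulfV ?gt_eqF // powRr1.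
have N1 : 1 <= N%:R :> R by rewrite ler1n.
apply: (@le_trans _ _ ((K%:R * N%:R ^+ 4) `^ j%:R^-1)).
  by apply: ge0_ler_powR => //; rewrite ?nnegrE ?invr_ge0 ?mulr_ge0 ?exprn_ge0.
rewrite powRM ?exprn_ge0 //; apply: ler_wpM2l; first exact: powR_ge0.
rewrite -powR_mulrn // -powRrM ler_powR //.
by rewrite ler_pdivrMr // mulrC -ler_pdivrMr // ltW.
Qed.

Lemma quadratic_horner (P : {poly int}) (x : int) : size P = 3%N ->
  P.[x] = P`_2 * x ^+ 2 + P`_1 * x + P`_0.
Proof. by move=> sP; rewrite horner_coef sP !big_ord_recr big_ord0 /=; ring. Qed.

Lemma quadratic_poly (P : {poly int}) : size P = 3%N ->
  P = (P`_2)%:P * 'X^2 + (P`_1)%:P * 'X + (P`_0)%:P.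
Proof.
move=> sP; apply/polyP => i; rewrite !coefD !coefCM coefXn coefX coefC.
case: i => [|[|[|i]]] /=; rewrite ?mulr0 ?mulr1 ?add0r ?addr0 //.
by rewrite nth_default // sP.
Qed.

(** A zero discriminant turns [P] into [a] times the square of ['X - z], with
    [z = - b / (2 * a)]. *)
Lemma separable_disc_neq0 (R : realType) (P : {poly int}) : size P = 3%N ->
  no_repeated_complex_root R P -> (P`_1) ^+ 2 - 4 * P`_2 * P`_0 != 0.
Proof.
move=> sP sep; apply/eqP => d0.
have a0 : P`_2 != 0 by rewrite -[2%N]/(3.-1) -sP -lead_coefE lead_coef_eq0 -size_poly_eq0 sP.
set a := P`_2 in a0 d0; set b := P`_1 in d0; set c := P`_0 in d0.
have aC0 : a%:~R != 0 :> R[i] by rewrite intr_eq0.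
pose z : R[i] := - b%:~R / (2 * a%:~R).
have bE : b%:~R = - 2 * a%:~R * z :> R[i].
  by rewrite /z; field; rewrite aC0.
have cE : c%:~R = a%:~R * z ^+ 2 :> R[i].
  have : (b%:~R) ^+ 2 = 4 * a%:~R * c%:~R :> R[i].
    by move/eqP: d0; rewrite subr_eq0 => /eqP /(congr1 (intr : int -> R[i])); rewrite rmorphXn !rmorphM.
  rewrite bE => h; apply: (mulfI aC0); apply: (@mulfI _ (4 : R[i])); first by rewrite pnatr_eq0.
  by rewrite [LHS]mulrA -h; ring.
have := sep z; clearbody z; apply/negP; rewrite negbK.
have -> : map_poly intr P = (a%:~R)%:P * ('X - z%:P) ^+ 2 :> {poly R[i]}.
  rewrite (quadratic_poly sP) -/a -/b -/c !rmorphD !rmorphM /= !map_polyC !map_polyX /= bE cE.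
  by rewrite !polyCM !polyCN polyCMn; ring.
by rewrite dvdp_mull.
Qed.

Theorem proposition6p1 (R : realType) (eps : R) (P : {poly int})
    (eps_gt0 : 0 < eps) (P_sep : no_repeated_complex_root R P)
    (P_deg2 : size P = 3%N) :
  exists2 C : R, 0 < C &
    forall N : nat, (2 <= N)%N ->
      (M4 N P)%:R <= C * N%:R `^ (3 / 2 + eps).
Proof.
have d0 := separable_disc_neq0 P_deg2 P_sep.
have a0 : P`_2 != 0 by rewrite -[2%N]/(3.-1) -P_deg2 -lead_coefE lead_coef_eq0 -size_poly_eq0 P_deg2.
set a := P`_2 in a0 d0; set b := P`_1 in d0; set c := P`_0 in d0.
have [c0 c00 c0P] := @qabs_bounds a b c a0.
(* [22 = 4 + 6 * 3]: four factors [W] from the labels, and six factors [loss], each containing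
   [W ^ 3]. *)
have [C C0 hC] := subpolynomial_witness c0 22 eps_gt0.
pose K : R := 256 * (16 * c0%:R) * (card_const a b c c0)%:R ^+ 6.
have K0 : 0 < K by rewrite !mulr_gt0 ?exprn_gt0 ?ltr0n // /card_const !muln_gt0 !addn1.
exists (K * C); first exact: mulr_gt0.
move=> N N2; have N0 : (0 < N)%N by apply: leq_trans N2.
have [W [W1 W2 W3]] := hC N N0.
have qabs_le n : (0 < n)%N -> (qabs a b c n <= c0 * n ^ 2)%N by case/c0P.
have le_qabs n : (0 < n)%N -> (0 < qabs a b c n)%N -> (n ^ 2 <= c0 * qabs a b c n)%N by case/c0P.
have qlin_le n : (0 < n)%N -> (`|qlin a b n| <= c0 * n)%N by case/c0P.
rewrite /M4; set S := [set n | _].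
have hS n : n \in S -> [/\ forall i : 'I_4, (0 < qabs a b c (n i).+1)%N,
    exists z, (\prod_(i < 4) sqfree_part (qabs a b c (n i).+1) = z ^ 2)%N & injective n].
  rewrite inE => /and3P[Q0 /asboolP[m mE] dist].
  have PE i : P.[(n i).+1%:Z] = qval a b c (n i).+1 by rewrite quadratic_horner.
  have okn i : (0 < qabs a b c (n i).+1)%N.
    by move/prodf_neq0: Q0 => /(_ i isT); rewrite PE -absz_gt0.
  split=> //.
    (* Up to sign, the product of the values is the product of the squarefree parts times [Y ^ 2].
       Hence [Y] divides [m], and the quotient is the root sought. *)
    pose Y := (\prod_(i < 4) sqroot_part (qabs a b c (n i).+1))%N.
    have Y0 : (0 < Y)%N by apply: prodn_gt0 => i; exact: sqroot_part_gt0.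
    have E : (\prod_(i < 4) sqfree_part (qabs a b c (n i).+1) * Y ^ 2 = `|m| ^ 2)%N.
      rewrite -abszX -mE (big_morph absz abszM (erefl _)) /Y -mulnn -!big_split /=.
      by apply: eq_bigr => i _; rewrite mulnn -sqfree_partE PE.
    have /dvdnP[w wE] : (Y %| `|m|)%N by rewrite -(@dvdn_pexp2r _ _ 2) // -E dvdn_mull.
    exists w; apply/eqP; rewrite -(@eqn_pmul2r (Y ^ 2)) ?expn_gt0 ?Y0 //.
    by rewrite E wE expnMn.
  move=> i j nij; apply/eqP; apply/negPn/negP => ij.
  have key (u v : 'I_4) : (u < v)%N -> n u = n v -> False.
    by move=> uv nuv; move/forallP/(_ u)/forallP/(_ v): dist; rewrite uv nuv eqxx.
  by move: ij; rewrite neq_ltn => /orP[/key|/key]; apply.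
have := card_square_tuples a0 d0 qabs_le le_qabs qlin_le W1 W2 R hS.
move/le_trans; apply.
rewrite powRD; last by rewrite pnatr_eq0 -lt0n N0 implybT.
have -> : N%:R `^ (3 / 2) = Num.sqrt N%:R ^+ 3 :> R.
  by rewrite -powR12_sqrt // -powR_mulrn ?powR_ge0 // -powRrM; congr (_ `^ _); field.
have -> : (256 * W ^ 4)%:R * (16 * c0%:R * Num.sqrt N%:R ^+ 3 * (loss a b c c0 W R) ^+ 6) =
   K * (Num.sqrt N%:R ^+ 3) * (W ^ 22)%:R :> R.
  by rewrite /loss (natrM _ 256) (natrM _ (card_const _ _ _ _)) (natrX _ W 4) (natrX _ W 3) (natrX _ W 22) /K; ring.
have -> : K * C * (Num.sqrt N%:R ^+ 3 * N%:R `^ eps) = K * Num.sqrt N%:R ^+ 3 * (C * N%:R `^ eps) by ring.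
by rewrite ler_wpM2l // mulr_ge0 ?exprn_ge0 ?sqrtr_ge0 // ltW.
Qed.
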